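(* There is a generic subset $\mathcal{G}$ of $\mathcal{S}^{I}_n$ such that, for every $\sigma\in\mathcal{G}$, there is some $\widehat{\sigma}\in\mathcal{G}$ such that (1) $\sigma$ and $\widehat{\sigma}$ are i/o equivalent under every constant input, but (2) $\sigma$ and $\widehat{\sigma}$ are not i/o equivalent.
   Context: A 4-tuple of dimension $n$ is $(A,N,b,c)$ with $A,N\in\mathbb{R}^{n\times n}$, $b\in\mathbb{R}^{n\times 1}$, $c\in\mathbb{R}^{1\times n}$. The bilinear system of type I associated with it is $\dot x=(A+uN)x+bu$, $x(0)=0$, $y=cx$. The class $\mathcal{S}^{I}_n$ of all $n$-dimensional bilinear systems of type I is identified with $\mathbb{R}^{2n^2+2n}$ via 4-tuples. A subset of $\mathbb{R}^\ell$ is called generic if it is open and dense and its complement has Lebesgue measure zero. Inputs are Lebesgue-measurable, essentially bounded functions $u:[0,T_u]\to\mathbb{R}$; $\Omega$ is the set of all inputs. Two systems are i/o equivalent under a set $\mathcal{U}\subseteq\Omega$ of inputs if for each $u\in\mathcal{U}$ the two outputs $y(t)$ coincide for all $t\in[0,T_u]$; they are i/o equivalent (no qualifier) if this holds with $\mathcal{U}=\Omega$. Constant inputs are $u\equiv\beta$, $\beta\in\mathbb{R}$ arbitrary.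
   Formalization: The formal statement assumes dimension n ≥ 2; for n = 0 and n = 1 the claim is false, since there i/o equivalence under every constant input already implies i/o equivalence and a generic (dense) set is nonempty. *)

(* Defs.v *)
(* Built on MathComp and MathComp-Analysis. *)
From HB Require Import structures.
From mathcomp Require Import all_boot all_order all_algebra.
From mathcomp Require Import all_classical all_reals all_analysis.

Set Implicit Arguments.
Unset Strict Implicit.
Unset Printing Implicit Defensive.

Import Order.TTheory GRing.Theory Num.Theory.
Import numFieldNormedType.Exports.

Local Open Scope classical_set_scope.
Local Open Scope ring_scope.

(* Lebesgue null sets of R^l: those of zero outer measure, i.e. covered by
   countably many closed boxes of arbitrarily small total volume. *)
Definition lebesgue_null (R : realType) (l : nat) (X : set 'rV[R]_l) : Prop :=
  forall eps : R, 0 < eps ->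
  exists lo hi : nat -> 'rV[R]_l,
    [/\ forall k i, lo k 0 i <= hi k 0 i,
        X `<=` \bigcup_k [set x | forall i, lo k 0 i <= x 0 i <= hi k 0 i] &
        (\sum_(0 <= k <oo) (\prod_(i < l) (hi k 0 i - lo k 0 i))%:E
           <= eps%:E)%E].

Definition generic (R : realType) (l : nat) (X : set 'rV[R]_l) : Prop :=
  [/\ open X, dense X & lebesgue_null (~` X)].

Record system (R : realType) (n : nat) := System {
  sysA : 'M[R]_n;
  sysN : 'M[R]_n;
  sysb : 'cV[R]_n;
  sysc : 'rV[R]_n
}.

(* The identification of the class of systems with R^(2n^2+2n). *)
Definition coords (R : realType) (n : nat) (s : system R n) :
    'rV[R]_((n * n + n * n) + (n + n)) :=
  row_mx (row_mx (mxvec (sysA s)) (mxvec (sysN s))) (row_mx (sysb s)^T (sysc s)).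

(* R with the sigma-algebra of Lebesgue measurable sets, i.e. the domain of
   completed_lebesgue_measure; the default one on R is the Borel sigma-algebra. *)
Definition lebesgueTypeR (R : realType) :=
  caratheodory_type ((wlength (@idfun R))^*)%mu.

(* An input is a function on [0, duration]; the values of input_fun outside
   that interval are junk and never used. *)
Record input (R : realType) := Input {
  duration : R;
  input_fun :> R -> R;
  duration_ge0 : 0 <= duration;
  input_measurable :
    measurable_fun (`[0, duration]%classic : set (lebesgueTypeR R)) input_fun;
  input_ess_bounded : exists M : R,
    {ae @lebesgue_measure R, forall t, t \in `[0, duration] -> `|input_fun t| <= M}
}.

Definition constant_input (R : realType) : set (input R) :=
  [set u | exists beta : R, forall t, t \in `[0, duration u] -> u t = beta].

Definition abs_continuous (R : realType) (a b : R) (f : R -> R) : Prop :=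
  forall eps : R, 0 < eps -> exists2 delta : R, 0 < delta &
  forall (m : nat) (l r : 'I_m -> R),
    (forall k, [/\ a <= l k, l k <= r k & r k <= b]) ->
    (forall j k, j != k -> r j <= l k \/ r k <= l j) ->
    \sum_(k < m) (r k - l k) < delta ->
    \sum_(k < m) `|f (r k) - f (l k)| < eps.

(* Solutions of x' = (A + u N) x + b u, x(0) = 0 on [0, duration u] in the sense
   of Caratheodory (u is merely measurable): absolutely continuous functions
   satisfying the equation almost everywhere. *)
Definition is_trajectory (R : realType) (n : nat) (s : system R n) (u : input R)
    (x : R -> 'cV[R]_n) : Prop :=
  [/\ x 0 = 0,
      forall i, abs_continuous 0 (duration u) (fun t => x t i 0) &
      {ae @lebesgue_measure R, forall t, t \in `]0, duration u[ ->
        forall i, is_derive t 1 (fun r => x r i 0)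
          (((sysA s + u t *: sysN s) *m x t + u t *: sysb s) i 0)}].

(* For each input the trajectory, hence the output, exists and is unique on
   [0, duration u]; y is unconstrained outside that interval. *)
Definition is_output (R : realType) (n : nat) (s : system R n) (u : input R)
    (y : R -> R) : Prop :=
  exists2 x : R -> 'cV[R]_n, is_trajectory s u x &
    forall t, t \in `[0, duration u] -> y t = (sysc s *m x t) 0 0.

Definition io_equiv_under (R : realType) (n : nat) (U : set (input R))
    (s1 s2 : system R n) : Prop :=
  forall u, U u -> forall y1 y2 : R -> R,
    is_output s1 u y1 -> is_output s2 u y2 ->
    forall t, t \in `[0, duration u] -> y1 t = y2 t.

Definition io_equiv (R : realType) (n : nat) (s1 s2 : system R n) : Prop :=
  io_equiv_under setT s1 s2.

(* Main.v *)
Require Import Defs.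
From mathcomp Require Import all_boot all_order all_algebra.
From mathcomp Require Import all_classical all_reals all_analysis.
From mathcomp Require Import ring lra.

(** Transposition is a symmetry of the responses to constant inputs.  To
    [s = (A, N, b, c)] associate the dual system [(A^T, N^T, c^T, b^T)].  Under
    the input [beta] the output of [s] depends only on the numbers
    [c (A + beta N)^k b], and a [1 x 1] matrix equals its transpose, so the dual
    system has the same numbers and the same constant-input responses.  A
    varying input also sees products in which [A] and [N] appear in a
    definite order, and transposition reverses that order: it exchanges
    [c A N b] and [c N A b].  Hence [s] and its dual are distinguishable as soon
    as [c (A N - N A) b <> 0], and this is the set [G].  It is stable under
    duality, because duality changes the sign of [c (A N - N A) b].

    Genericity of [G].  The polynomial [c (A N - N A) b] is affine in each
    single coordinate.  If [P] is affine in one coordinate with slope [q], and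
    [q] is nonzero on a generic set, so is [P] ([generic_affine_step]): where
    [q <> 0] the zero set of [P] is locally a Lipschitz graph.  Four such steps, in
    one entry each of [c], [b], [A] and [N], lead from [c (A N - N A) b] to the
    constant 1; two distinct indices are required here, which is why the
    dimension is at least 2.

    Equivalence under constant inputs ([dual_io_equiv_constant]).  Trajectories
    are only absolutely continuous, with a derivative almost everywhere, so it
    is first shown that for a constant input they satisfy the equation at
    every interior time ([abs_continuous_is_derive]).  If [p] and [q] denote the
    velocities of the two systems, [q (t - s)^T p s] is then constant in [s];
    its values at [s = 0] and [s = t] give [beta y1' = beta y2'].  When
    [beta = 0] both trajectories vanish, by Gronwall's inequality.

    Inequivalence ([dual_not_io_equiv]).  Under the input [u t = 1 + t] on a
    short interval the trajectories are convergent power series, whose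
    coefficients obey a two-term recursion.  The fourth Taylor coefficients of
    the two outputs differ by [- c (A N - N A) b / 24]
    ([ramp_output_coef4_gap]), and a power series that vanishes on an interval
    [(0, T)] has zero coefficients ([pseries_vanish]). *)

Set Implicit Arguments.
Unset Strict Implicit.
Unset Printing Implicit Defensive.

Import Order.TTheory GRing.Theory Num.Theory.
Import numFieldNormedType.Exports.

Local Open Scope classical_set_scope.
Local Open Scope ring_scope.

(** * Lebesgue null sets in R^l *)

Definition box (R : realType) (l : nat) (lo hi : 'rV[R]_l) : set 'rV[R]_l :=
  [set x | forall i, lo 0 i <= x 0 i <= hi 0 i].

Definition box_vol (R : realType) (l : nat) (lo hi : 'rV[R]_l) : R :=
  \prod_(i < l) (hi 0 i - lo 0 i).

Lemma box_vol_ge0 (R : realType) (l : nat) (lo hi : 'rV[R]_l) :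
  (forall i, lo 0 i <= hi 0 i) -> 0 <= box_vol lo hi.
Proof. by move=> H; apply: prodr_ge0 => i _; rewrite subr_ge0. Qed.

Lemma lebesgue_null_sub (R : realType) (l : nat) (X Y : set 'rV[R]_l) :
  X `<=` Y -> lebesgue_null Y -> lebesgue_null X.
Proof.
move=> XY nY e e0; have [lo [hi [h1 h2 h3]]] := nY e e0.
by exists lo, hi; split => //; apply: subset_trans XY h2.
Qed.

Lemma lebesgue_null_bigcup (R : realType) (l : nat) (X : nat -> set 'rV[R]_l) :
  (forall k, lebesgue_null (X k)) -> lebesgue_null (\bigcup_k X k).
Proof.
move=> nX e e0.
have e2 k : 0 < e / (2 ^ k.+1)%:R by rewrite divr_gt0// ltr0n expn_gt0.
have /choice[lo /choice[hi H]] k := nX k _ (e2 k).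
have /card_esym/ppcard_eqP[f] := card_nat2.
exists (fun k => lo (f k).1 (f k).2), (fun k => hi (f k).1 (f k).2); split.
- by move=> k i; have [+ _ _] := H (f k).1; exact.
- move=> x [k _ Xkx]; have [_ + _] := H k => /(_ _ Xkx)[j _ xj].
  have [m _ fm] : exists2 m, setT m & f m = (k, j).
    by exists (f^-1%FUN (k, j)) => //; rewrite invK// inE.
  by exists m => //=; rewrite fm.
have v0 k j : (0 <= (box_vol (lo k j) (hi k j))%:E)%E.
  by rewrite lee_fin; apply: box_vol_ge0 => i; have [+ _ _] := H k; exact.
apply: le_trans (epsilon_trick0 xpredT (ltW e0)).
rewrite nneseries_esumT; last by move=> k; exact: v0.
rewrite -(@reindex_esum _ _ _ setT setT f
  (fun p => (box_vol (lo p.1 p.2) (hi p.1 p.2))%:E)); last exact: bij.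
have -> : [set: nat * nat] = [set: nat] `*`` (fun=> [set: nat]).
  by apply/seteqP; split.
rewrite -(@esum_esum _ _ _ _ _ (fun k j => (box_vol (lo k j) (hi k j))%:E));
  last by move=> *; exact: v0.
rewrite nneseries_esumT; last by move=> k; rewrite lee_fin ltW.
apply: le_esum => k _; rewrite -nneseries_esumT; last by move=> j; exact: v0.
by have [_ _] := H k.
Qed.

Lemma lebesgue_null_setU (R : realType) (l : nat) (X Y : set 'rV[R]_l) :
  lebesgue_null X -> lebesgue_null Y -> lebesgue_null (X `|` Y).
Proof.
move=> nX nY.
apply: (@lebesgue_null_sub _ _ _ (\bigcup_k (if k is 0%N then X else Y))).
  by move=> x [Xx|Yx]; [exists 0%N|exists 1%N].
by apply: lebesgue_null_bigcup => -[|k].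
Qed.

(** A finite cover becomes a sequence by padding with a degenerate box; it has
    volume zero because the ambient space has a coordinate [i0]. *)
Lemma lebesgue_null_fin_cover (R : realType) (l : nat) (i0 : 'I_l) (X : set 'rV[R]_l) :
  (forall eps : R, 0 < eps -> exists (I : finType) (lo hi : I -> 'rV[R]_l),
    [/\ forall k i, lo k 0 i <= hi k 0 i,
        forall x, X x -> exists k, box (lo k) (hi k) x &
        \sum_k box_vol (lo k) (hi k) <= eps]) ->
  lebesgue_null X.
Proof.
move=> H e /H[I [lo [hi [h1 h2 h3]]]].
pose ext (g : I -> 'rV[R]_l) (k : nat) :=
  if (insub k : option 'I_#|I|) is Some j then g (enum_val j) else 0.
exists (ext lo), (ext hi); split.
- by move=> k i; rewrite /ext; case: insubP => [j|]; rewrite ?h1.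
- move=> x /h2[k xk]; exists (enum_rank k : nat) => //=.
  by rewrite /ext valK enum_rankK.
have v0 k : (0 <= (box_vol (ext lo k) (ext hi k))%:E)%E.
  rewrite lee_fin box_vol_ge0// => i.
  by rewrite /ext; case: insubP => [j|]; rewrite ?h1.
rewrite (@nneseries_split _ (fun k => (box_vol (ext lo k) (ext hi k))%:E) 0%N #|I|);
  last by move=> k _; exact: v0.
rewrite eseries0 ?adde0; last first.
  move=> k Ik _; rewrite /ext insubF; last by apply/negbTE; rewrite -leqNgt.
  by rewrite /box_vol (bigD1 i0)//= subrr mul0r.
rewrite add0n big_mkord sumEFin lee_fin; apply: le_trans h3.
rewrite [leRHS](reindex _ (onW_bij _ (@enum_val_bij I))) /=.
by rewrite le_eqVlt; apply/orP; left; apply/eqP; apply: eq_bigr => k _; rewrite /ext valK.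
Qed.

(** Cut the cube into columns parallel to the axis [i], of width [h].  By the
    Lipschitz condition the part of [Z] inside one column fits in a box of height
    [2 C h], so the total volume is at most a constant times [h].  Stated as a
    two-point condition on [Z], this covers the graphs of Lipschitz functions
    without naming the function or its domain. *)
Lemma lipschitz_graph_null (R : realType) (l : nat) (i : 'I_l) (K C : R)
    (Z : set 'rV[R]_l) :
  0 < K -> 0 < C -> (forall x, Z x -> forall j, `|x 0 j| <= K) ->
  (forall x y (h : R), Z x -> Z y -> 0 <= h -> (forall j, j != i -> `|x 0 j - y 0 j| <= h) ->
     `|x 0 i - y 0 i| <= C * h) ->
  lebesgue_null Z.
Proof.
move=> K0 C0 ZK ZC; apply: (lebesgue_null_fin_cover i) => e e0.
(* [B / m] bounds the total volume of the boxes for a grid of mesh [2 K / m]. *)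
pose B := (4 * K) ^+ l.-1 * (2 * C * (2 * K)).
have B0 : 0 < B by rewrite !mulr_gt0// exprn_gt0// mulr_gt0.
pose m := (Num.trunc (B / e)).+1.
pose h := 2 * K / m%:R.
have m0 : 0 < m%:R :> R by rewrite ltr0n.
have m1 : 1 <= m%:R :> R by rewrite ler1n.
have h0 : 0 < h by rewrite divr_gt0// mulr_gt0.
have hm : h * m%:R = 2 * K by rewrite /h divfK// gt_eqF.
have Bm : B / m%:R <= e.
  by rewrite ler_pdivrMr// mulrC -ler_pdivrMr// ltW// truncnS_gt.
(* [m + 1] cells per axis: the face [x j = K] falls in the last one. *)
pose cell (x : 'rV[R]_l) (j : 'I_l) : 'I_m.+1 := inord (Num.trunc ((x 0 j + K) / h)).
have cellP x j : Z x -> (cell x j)%:R * h <= x 0 j + K <= (cell x j)%:R * h + h.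
  move=> Zx; have xj0 : 0 <= (x 0 j + K) / h.
    by rewrite divr_ge0 ?(ltW h0)//; have := ZK x Zx j; rewrite ler_norml; lra.
  have lem : (Num.trunc ((x 0%R j + K) / h)%R < m.+1)%N.
    rewrite truncn_lt_nat// ltr_pdivrMr// -natr1 mulrDl mul1r mulrC hm.
    by have := ZK x Zx j; rewrite ler_norml; lra.
  rewrite /cell inordK//; have /andP[a b] := truncn_itv xj0.
  by rewrite -[X in _ <= _ * _ + X]mul1r -mulrDl natr1 -ler_pdivlMr// a -ler_pdivrMr// ltW.
(* Columns are indexed by the grid cells with [i]-th index 0; the other cells receive
   a degenerate box, so that the sum of volumes factors as a product of sums. *)
pose F := {ffun 'I_l -> 'I_m.+1}.
pose pt (f : F) : 'rV[R]_l :=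
  xget 0 [set z | Z z /\ forall j, j != i -> cell z j = f j].
pose lo (f : F) : 'rV[R]_l := \row_j
  if j == i then (if f i == 0 then pt f 0 i - C * h else 0) else (f j)%:R * h - K.
pose hi (f : F) : 'rV[R]_l := \row_j
  if j == i then (if f i == 0 then pt f 0 i + C * h else 0) else (f j)%:R * h - K + h.
have Ch : 0 < C * h by rewrite mulr_gt0.
exists F, lo, hi; split.
- move=> f j; rewrite !mxE; case: eqP => _; last by lra.
  by case: ifP => // _; lra.
- move=> x Zx; pose f : F := [ffun j => if j == i then 0 else cell x j].
  have fi : f i = 0 by rewrite ffunE eqxx.
  have [Zp cp] : Z (pt f) /\ forall j, j != i -> cell (pt f) j = f j.
    rewrite /pt; case: xgetP => // /(_ x) []; split => // j ji.
    by rewrite ffunE (negbTE ji).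
  exists f => j; rewrite !mxE; case: eqP => [->|/eqP ji].
    rewrite fi eqxx -ler_distlC distrC; apply: ZC => //; first exact: ltW.
    move=> k ki.
    have := cellP (pt f) k Zp; have := cellP x k Zx.
    rewrite cp// ffunE (negbTE ki) ler_norml; lra.
  by have := cellP x j Zx; rewrite ffunE (negbTE ji); lra.
pose s (j : 'I_l) (k : 'I_m.+1) : R :=
  if j == i then (if k == 0 then 2 * (C * h) else 0) else h.
rewrite (eq_bigr (fun f : F => \prod_j s j (f j))); last first.
  move=> f _; apply: eq_bigr => j _; rewrite !mxE /s.
  by case: eqP => [->|_]; [case: eqP => _; lra|lra].
rewrite -(bigA_distr_bigA s) (bigD1 i)//=.
have -> : \sum_j s i j = 2 * (C * h).
  by rewrite (bigD1 ord0)//= /s eqxx eqxx big1 ?addr0// => k /negbTE ->.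
rewrite (eq_bigr (fun=> h * m.+1%:R)); last first.
  by move=> j ji; rewrite /s (negbTE ji) sumr_const card_ord mulr_natr.
rewrite prodr_const.
have -> : #|[pred j | j != i]| = l.-1 by rewrite cardC1 card_ord.
apply: le_trans Bm; rewrite /B.
have -> : (4 * K) ^+ l.-1 * (2 * C * (2 * K)) / m%:R = 2 * (C * h) * (4 * K) ^+ l.-1.
  by rewrite /h; ring.
apply: ler_pM => //; [by rewrite ltW// mulr_gt0|by rewrite exprn_ge0// mulr_ge0// ltW|].
apply: lerXn2r; rewrite ?nnegrE ?mulr_ge0 ?(ltW h0) ?(ltW K0)//.
have hK : h <= 2 * K by rewrite /h ler_pdivrMr// ler_peMr// mulr_ge0// ltW.
by rewrite -natr1 mulrDr hm; lra.
Qed.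

(** * Functions that are Lipschitz on cubes *)

(** Lipschitz continuity in the sup norm on each bounded cube, the bound [h]
    standing for the sup distance.  Unlike global Lipschitz continuity it is
    stable under products, hence holds for polynomial functions. *)
Definition lipschitz_on_cubes (R : realType) (l : nat) (F : 'rV[R]_l -> R) :=
  forall K : R, exists2 L : R, 0 < L & forall (x y : 'rV[R]_l) (h : R),
    (forall j, `|x 0 j| <= K) -> (forall j, `|y 0 j| <= K) -> 0 <= h ->
    (forall j, `|x 0 j - y 0 j| <= h) -> `|F x - F y| <= L * h.

Lemma row_bound (R : realType) (l : nat) (x : 'rV[R]_l) :
  exists2 K : R, 0 <= K & forall j, `|x 0 j| <= K.
Proof.
exists (\sum_j `|x 0 j|); first by rewrite sumr_ge0.
by move=> j; rewrite (bigD1 j)//= lerDl sumr_ge0.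
Qed.

Lemma lipschitz_on_cubes_bound (R : realType) (l : nat) (F : 'rV[R]_l -> R) (K : R) :
  0 <= K -> lipschitz_on_cubes F ->
  exists2 M : R, 0 < M & forall x : 'rV[R]_l, (forall j, `|x 0 j| <= K) -> `|F x| <= M.
Proof.
move=> K0 /(_ K)[L L0 HL]; exists (L * K + `|F 0| + 1).
  by rewrite ltr_wpDl// addr_ge0// mulr_ge0// ltW.
move=> x xK; have := HL x 0 K xK.
have h0 j : `|(0 : 'rV[R]_l) 0 j| <= K by rewrite mxE normr0.
have h1 j : `|x 0 j - (0 : 'rV[R]_l) 0 j| <= K by rewrite mxE subr0.
move=> /(_ h0 K0 h1) H.
by have := ler_normD (F x - F 0) (F 0); rewrite subrK; lra.
Qed.

Lemma lipschitz_on_cubes_cst (R : realType) (l : nat) (a : R) :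
  lipschitz_on_cubes (fun _ : 'rV[R]_l => a).
Proof.
by move=> K; exists 1 => // x y h _ _ h0 _; rewrite subrr normr0 mul1r.
Qed.

Lemma lipschitz_on_cubes_coord (R : realType) (l : nat) (j : 'I_l) :
  lipschitz_on_cubes (fun x : 'rV[R]_l => x 0 j).
Proof. by move=> K; exists 1 => // x y h _ _ _; rewrite mul1r. Qed.

Lemma lipschitz_on_cubesD (R : realType) (l : nat) (F G : 'rV[R]_l -> R) :
  lipschitz_on_cubes F -> lipschitz_on_cubes G ->
  lipschitz_on_cubes (fun x => F x + G x).
Proof.
move=> HF HG K; have [L1 L10 H1] := HF K; have [L2 L20 H2] := HG K.
exists (L1 + L2); first exact: addr_gt0.
move=> x y h xK yK h0 xy; rewrite opprD addrACA mulrDl.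
by rewrite (le_trans (ler_normD _ _))// lerD ?H1 ?H2.
Qed.

Lemma lipschitz_on_cubesM (R : realType) (l : nat) (F G : 'rV[R]_l -> R) :
  lipschitz_on_cubes F -> lipschitz_on_cubes G ->
  lipschitz_on_cubes (fun x => F x * G x).
Proof.
move=> HF HG K; have K0 : 0 <= `|K| by [].
have [L1 L10 H1] := HF K; have [L2 L20 H2] := HG K.
have [M1 M10 B1] := lipschitz_on_cubes_bound K0 HF.
have [M2 M20 B2] := lipschitz_on_cubes_bound K0 HG.
exists (L1 * M2 + M1 * L2); first by rewrite addr_gt0// mulr_gt0.
move=> x y h xK yK h0 xy.
have -> : F x * G x - F y * G y = (F x - F y) * G x + F y * (G x - G y) by ring.
have KK := ler_norm K.
rewrite (le_trans (ler_normD _ _))// [leRHS]mulrDl !normrM lerD//.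
  rewrite mulrAC ler_pM// ?H1//; apply: B2 => j; exact: le_trans (xK j) KK.
by rewrite -mulrA ler_pM// ?H2//; apply: B1 => j; exact: le_trans (yK j) KK.
Qed.

Lemma lipschitz_on_cubes_sum (R : realType) (l : nat) (I : finType)
    (F : I -> 'rV[R]_l -> R) :
  (forall i, lipschitz_on_cubes (F i)) ->
  lipschitz_on_cubes (fun x => \sum_i F i x).
Proof.
move=> HF; rewrite -fct_sumE; apply: big_ind => //.
- exact: lipschitz_on_cubes_cst.
- exact: lipschitz_on_cubesD.
Qed.

Lemma lipschitz_on_cubes_cvg (R : realType) (l : nat) (F : 'rV[R]_l -> R)
    (x : 'rV[R]_l) (e : R) :
  lipschitz_on_cubes F -> 0 < e -> \forall y \near x, `|F x - F y| < e.
Proof.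
move=> HF e0; have [K K0 xK] := row_bound x.
have [L L0 HL] := HF (K + 1).
have d0 : 0 < Num.min 1 (e / (2 * L)) by rewrite lt_min ltr01/= divr_gt0// mulr_gt0.
apply/nbhs_ballP; exists (Num.min 1 (e / (2 * L))) => //= y [_ xy].
have xyj j : `|x 0 j - y 0 j| < Num.min 1 (e / (2 * L)) by exact: xy.
apply: (@le_lt_trans _ _ (L * (e / (2 * L)))); last first.
  by have -> : L * (e / (2 * L)) = e / 2; [field; rewrite gt_eqF|lra].
apply: HL => [j|j||j].
- by have := xK j; lra.
- have := xyj j; rewrite lt_min => /andP[+ _].
  have := ler_distD (x 0 j) (y 0 j) 0; rewrite !subr0 distrC; have := xK j; lra.
- by rewrite divr_ge0 ?mulr_ge0 ?ltW.
- by have := xyj j; rewrite lt_min => /andP[_ /ltW].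
Qed.

Lemma generic_setT (R : realType) (l : nat) (i : 'I_l) : generic [set: 'rV[R]_l].
Proof.
split; [exact: openT|by move=> O [x Ox] _; exists x|].
rewrite setCT; apply: (lebesgue_null_fin_cover i) => e e0.
by exists void, (fun=> 0), (fun=> 0); split => //; rewrite big_pred0 ?ltW// => -[].
Qed.

(** On the part of the zero set lying in a bounded cube, where [`|q|] is bounded
    below, two zeros [x], [y] satisfy the Lipschitz graph condition: moving [y]
    along the axis [i] to the [i]-th coordinate of [x] changes [P] by
    [(x i - y i) q y], and the point reached is as close to [x] as the other
    coordinates allow. *)
Lemma affine_zeros_null (R : realType) (l : nat) (i : 'I_l) (P q : 'rV[R]_l -> R) :
  lipschitz_on_cubes P ->
  (forall v t, P (v + t *: delta_mx 0 i) = P v + t * q v) ->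
  lebesgue_null [set v | P v = 0 /\ q v != 0].
Proof.
move=> LP Pq.
pose Z k := [set v | [/\ P v = 0, forall j, `|v 0 j| <= k.+1%:R & k.+1%:R^-1 <= `|q v|]].
apply: (@lebesgue_null_sub _ _ _ (\bigcup_k Z k)).
  move=> v [Pv qv]; have [K K0 vK] := row_bound v.
  pose B := `|K| + `|q v|^-1; have B0 : 0 <= B by rewrite addr_ge0.
  exists (Num.trunc B) => //; have Bt := ltW (truncnS_gt B); split => //.
    move=> j; apply: le_trans (vK j) _; apply: le_trans Bt.
    by rewrite /B (le_trans (ler_norm K))// lerDl.
  rewrite invf_ple ?posrE ?ltr0n ?normr_gt0//; apply: le_trans Bt.
  by rewrite /B lerDr.
apply: lebesgue_null_bigcup => k.
have [L L0 HL] := LP k.+1%:R.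
apply: (@lipschitz_graph_null _ _ i k.+1%:R (k.+1%:R * L)) => //.
- by rewrite mulr_gt0.
- by move=> x [].
move=> x y h [Px xK qx] [Py yK qy] h0 xy.
pose y' := y + (x 0 i - y 0 i) *: delta_mx 0 i.
have y'E j : y' 0 j = if j == i then x 0 i else y 0 j.
  by rewrite !mxE /=; case: eqP => [->|_]; rewrite ?mulr1 ?mulr0 ?addr0// subrKC.
have : `|P x - P y'| <= L * h.
  apply: HL => // j; rewrite y'E; case: eqP => [ji|/eqP ji] //.
    by rewrite ji subrr normr0.
  exact: xy.
rewrite /y' Pq Px Py !add0r normrN normrM => H.
have q0 : 0 < `|q y| by apply: lt_le_trans qy; rewrite invr_gt0 ltr0n.
rewrite -mulrA; apply: (@le_trans _ _ (k.+1%:R * (`|x 0 i - y 0 i| * `|q y|))); last first.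
  by rewrite ler_wpM2l.
rewrite mulrCA ler_peMr// mulrC -ler_pdivrMr ?ltr0n//.
by rewrite div1r.
Qed.

(** * Genericity of the nonvanishing of c (AN - NA) b *)

(** Density: near a point where [q] does not vanish, moving along the axis [i] makes
    [P] nonzero.  Null complement: a zero of [P] is either a zero of [q] or belongs to
    the null set of [affine_zeros_null]. *)
Lemma generic_affine_step (R : realType) (l : nat) (i : 'I_l) (P q : 'rV[R]_l -> R) :
  lipschitz_on_cubes P ->
  (forall v t, P (v + t *: delta_mx 0 i) = P v + t * q v) ->
  generic [set v | q v != 0] -> generic [set v | P v != 0].
Proof.
move=> LP Pq [_ dq nq]; split.
- rewrite openE => v /= Pv; rewrite /interior /=.
  have Pv0 : 0 < `|P v| by rewrite normr_gt0.
  apply: filterS (lipschitz_on_cubes_cvg v LP Pv0) => w; apply: contraTneq => ->.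
  by rewrite subr0 ltxx.
- move=> O O0 oO; have [v [Ov /= qv]] := dq O O0 oO.
  have [Pv|Pv] := eqVneq (P v) 0; last by exists v.
  have cv : (fun t : R => v + t *: delta_mx 0 i) x @[x --> 0] --> v.
    rewrite -[X in _ --> X]addr0 -(scale0r (delta_mx 0 i)).
    by apply: cvgD; [exact: cvg_cst|apply: cvgZr_tmp; exact: cvg_id].
  have nO : nbhs v O by apply: open_nbhs_nbhs.
  have /nbhs_ballP[e /= e0 He] := cv _ nO.
  exists (v + (e / 2) *: delta_mx 0 i); split.
    apply: He; rewrite /ball /= sub0r normrN gtr0_norm; lra.
  by rewrite /= Pq Pv add0r mulf_neq0// gt_eqF// divr_gt0.
- apply: (@lebesgue_null_sub _ _ _ ([set v | P v = 0 /\ q v != 0] `|` ~` [set v | q v != 0])).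
    move=> v /= /negP; rewrite negbK => /eqP Pv.
    by have [qv|qv] := eqVneq (q v) 0; [right; apply/negP; rewrite negbK; exact/eqP|left].
  by apply: lebesgue_null_setU nq; exact: affine_zeros_null LP Pq.
Qed.

Definition lipschitz_entries (R : realType) (l m n : nat) (F : 'rV[R]_l -> 'M[R]_(m, n)) :=
  forall i j, lipschitz_on_cubes (fun v => F v i j).

Lemma lipschitz_entries_cst (R : realType) (l m n : nat) (M : 'M[R]_(m, n)) :
  lipschitz_entries (fun _ : 'rV[R]_l => M).
Proof. by move=> i j; exact: lipschitz_on_cubes_cst. Qed.

Lemma lipschitz_entriesB (R : realType) (l m n : nat) (F G : 'rV[R]_l -> 'M[R]_(m, n)) :
  lipschitz_entries F -> lipschitz_entries G -> lipschitz_entries (fun v => F v - G v).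
Proof.
move=> HF HG i j.
have -> : (fun v => (F v - G v) i j) = (fun v => F v i j + (-1) * G v i j).
  by apply/funext => v; rewrite !mxE mulN1r.
apply: lipschitz_on_cubesD (HF i j) _; apply: lipschitz_on_cubesM (HG i j).
exact: lipschitz_on_cubes_cst.
Qed.

Lemma lipschitz_entriesM (R : realType) (l m n p : nat) (F : 'rV[R]_l -> 'M[R]_(m, n))
    (G : 'rV[R]_l -> 'M[R]_(n, p)) :
  lipschitz_entries F -> lipschitz_entries G -> lipschitz_entries (fun v => F v *m G v).
Proof.
move=> HF HG i j.
have -> : (fun v => (F v *m G v) i j) = (fun v => \sum_k F v i k * G v k j).
  by apply/funext => v; rewrite !mxE.
by apply: lipschitz_on_cubes_sum => k; exact: lipschitz_on_cubesM.
Qed.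

Section commutator.
Variables (R : realType) (n : nat).
Local Notation dim := ((n * n + n * n) + (n + n))%N.

Definition commutator_form (A N : 'M[R]_n) (b : 'cV[R]_n) (c : 'rV[R]_n) : R :=
  (c *m (A *m N - N *m A) *m b) 0 0.

Lemma mulmx_entry_linear (c : 'rV[R]_n) (X Y : 'M[R]_n) (b : 'cV[R]_n) t :
  (c *m (X + t *: Y) *m b) 0 0 = (c *m X *m b) 0 0 + t * (c *m Y *m b) 0 0.
Proof. by rewrite mulmxDr mulmxDl -scalemxAr -scalemxAl !mxE. Qed.

Lemma commutator_form_linA A A' N b c t :
  commutator_form (A + t *: A') N b c = commutator_form A N b c + t * commutator_form A' N b c.
Proof.
rewrite /commutator_form (mulmxDl A) (mulmxDr N) opprD addrACA -scalemxAl -scalemxAr -scalerBr.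
exact: mulmx_entry_linear.
Qed.

Lemma commutator_form_linN A N N' b c t :
  commutator_form A (N + t *: N') b c = commutator_form A N b c + t * commutator_form A N' b c.
Proof.
rewrite /commutator_form (mulmxDr A) (mulmxDl N) opprD addrACA -scalemxAl -scalemxAr -scalerBr.
exact: mulmx_entry_linear.
Qed.

Lemma commutator_form_linb A N b b' c t :
  commutator_form A N (b + t *: b') c = commutator_form A N b c + t * commutator_form A N b' c.
Proof. by rewrite /commutator_form; set M := c *m _; rewrite mulmxDr -scalemxAr !mxE. Qed.

Lemma commutator_form_linc A N b c c' t :
  commutator_form A N b (c + t *: c') = commutator_form A N b c + t * commutator_form A N b c'.
Proof. by rewrite /commutator_form; set M := A *m N - _; rewrite !mulmxDl -!scalemxAl !mxE. Qed.

Definition coordA (v : 'rV[R]_dim) : 'M[R]_n := vec_mx (lsubmx (lsubmx v)).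
Definition coordN (v : 'rV[R]_dim) : 'M[R]_n := vec_mx (rsubmx (lsubmx v)).
Definition coordb (v : 'rV[R]_dim) : 'cV[R]_n := (lsubmx (rsubmx v))^T.
Definition coordc (v : 'rV[R]_dim) : 'rV[R]_n := rsubmx (rsubmx v).

Lemma coords_image (p : 'M[R]_n -> 'M[R]_n -> 'cV[R]_n -> 'rV[R]_n -> Prop) :
  @coords R n @` [set s | p (sysA s) (sysN s) (sysb s) (sysc s)] =
  [set v | p (coordA v) (coordN v) (coordb v) (coordc v)].
Proof.
apply/seteqP; split => [_ [s ps <-]|v pv] /=.
  by rewrite /coordA /coordN /coordb /coordc /coords !(row_mxKl, row_mxKr) !mxvecK trmxK.
exists (System (coordA v) (coordN v) (coordb v) (coordc v)) => //.
by rewrite /coords /= !vec_mxK trmxK !hsubmxK.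
Qed.

Lemma lipschitz_coords :
  [/\ lipschitz_entries coordA, lipschitz_entries coordN,
      lipschitz_entries coordb & lipschitz_entries coordc].
Proof.
split => i j; rewrite /coordA /coordN /coordb /coordc; [| |rewrite (ord1 j)|rewrite (ord1 i)].
all: under eq_fun do rewrite !mxE; exact: lipschitz_on_cubes_coord.
Qed.

Lemma lipschitz_commutator_form A N b c :
  lipschitz_entries A -> lipschitz_entries N -> lipschitz_entries b -> lipschitz_entries c ->
  lipschitz_on_cubes (fun v : 'rV[R]_dim => commutator_form (A v) (N v) (b v) (c v)).
Proof.
move=> hA hN hb hc; rewrite /commutator_form.
by do ![apply: lipschitz_entriesM|apply: lipschitz_entriesB].
Qed.

(** Replace one at a time [c] by [e_i0], [b] by [e_i1], [A] by [E_(i0,i1)] and [N] by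
    [E_(i1,i1)]: each replacement is the slope of the previous expression in one
    coordinate, and the last expression is the constant 1. *)
Lemma generic_commutator (i0 i1 : 'I_n) : i0 != i1 ->
  generic (@coords R n @` [set s | commutator_form (sysA s) (sysN s) (sysb s) (sysc s) != 0]).
Proof.
move=> i01; rewrite (coords_image (fun A N b c => commutator_form A N b c != 0)).
have [LA LN Lb Lc] := lipschitz_coords.
pose kc := rshift (n * n + n * n) (rshift n i0) : 'I_dim.
pose kb := rshift (n * n + n * n) (lshift n i1) : 'I_dim.
pose kA := lshift (n + n) (lshift (n * n) (mxvec_index i0 i1)) : 'I_dim.
pose kN := lshift (n + n) (rshift (n * n) (mxvec_index i1 i1)) : 'I_dim.
have cst := lipschitz_entries_cst.
apply: (@generic_affine_step _ _ kc _
  (fun v => commutator_form (coordA v) (coordN v) (coordb v) (delta_mx 0 i0))).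
- exact: lipschitz_commutator_form.
- move=> v t; rewrite /coordA /coordN /coordb /coordc !linearD !linearZ /=.
  rewrite /kc !delta_mx_rshift !(row_mxKl, row_mxKr) !linear0 !addr0.
  exact: commutator_form_linc.
apply: (@generic_affine_step _ _ kb _
  (fun v => commutator_form (coordA v) (coordN v) (delta_mx i1 0) (delta_mx 0 i0))).
- by apply: lipschitz_commutator_form => //; exact: cst.
- move=> v t; rewrite /coordA /coordN /coordb !linearD !linearZ /=.
  rewrite /kb !delta_mx_rshift !delta_mx_lshift !(row_mxKl, row_mxKr) !linear0 !addr0.
  by rewrite trmx_delta commutator_form_linb.
apply: (@generic_affine_step _ _ kA _
  (fun v => commutator_form (delta_mx i0 i1) (coordN v) (delta_mx i1 0) (delta_mx 0 i0))).
- by apply: lipschitz_commutator_form => //; exact: cst.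
- move=> v t; rewrite /coordA /coordN !linearD !linearZ /=.
  rewrite /kA !delta_mx_lshift !(row_mxKl, row_mxKr) !linear0 !addr0 vec_mx_delta.
  exact: commutator_form_linA.
apply: (@generic_affine_step _ _ kN _
  (fun v => commutator_form (delta_mx i0 i1) (delta_mx i1 i1) (delta_mx i1 0) (delta_mx 0 i0))).
- by apply: lipschitz_commutator_form => //; exact: cst.
- move=> v t; rewrite /coordN !linearD !linearZ /=.
  rewrite /kN !delta_mx_lshift !delta_mx_rshift !(row_mxKl, row_mxKr) vec_mx_delta.
  exact: commutator_form_linN.
rewrite (_ : [set _ | _] = setT); first exact: generic_setT kN.
apply/seteqP; split => // v _ /=.
rewrite /commutator_form mul_delta_mx mul_delta_mx_0; last by rewrite eq_sym.
by rewrite subr0 !mul_delta_mx mxE !eqxx oner_neq0.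
Qed.

End commutator.

(** * Absolutely continuous functions *)

(** First-order expansion with an explicit radius, the form in which derivatives
    enter the covering argument below. *)
Lemma is_derive_bound (R : realType) (f : R -> R) (x d : R) :
  is_derive x 1 f d <->
  forall e : R, 0 < e -> exists2 h : R, 0 < h &
    forall y, `|y - x| < h -> `|f y - f x - d * (y - x)| <= e * `|y - x|.
Proof.
split=> [[df <-] e e0|H].
- have dl : (fun h : R => h^-1 *: (f (h *: 1 + x) - f x)) h @[h --> 0^'] --> 'D_1 f x.
    exact: df.
  have /cvgrPdist_le/(_ e e0) := dl.
  rewrite near_withinE => /nbhs_ballP[h /= h0 Hh]; exists h => // y yx.
  have [->|yx0] := eqVneq y x; first by rewrite !subrr mulr0 subrr normr0 mulr0.
  have := Hh (y - x); rewrite /ball /= sub0r normrN => /(_ yx); rewrite subr_eq0 => /(_ yx0).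
  rewrite [_ *: 1]mulr1 subrK [_ *: _]mulrC => H.
  have yx1 : y - x != 0 by rewrite subr_eq0.
  have -> : f y - f x - 'D_1 f x * (y - x) = - (('D_1 f x - (f y - f x) / (y - x)) * (y - x)).
    by field.
  by rewrite normrN normrM ler_wpM2r.
- have dl : (fun h : R => h^-1 *: (f (h *: 1 + x) - f x)) h @[h --> 0^'] --> d.
    apply/cvgrPdist_le => e e0; have [h h0 Hh] := H e e0.
    rewrite near_withinE; apply/nbhs_ballP; exists h => //= t.
    rewrite /ball /= sub0r normrN => th t0.
    have := Hh (t + x); rewrite addrK => /(_ th).
    rewrite [_ *: 1]mulr1 [_ *: _]mulrC -ler_pdivrMr ?normr_gt0// -normf_div; apply: le_trans.
    by rewrite distrC le_eqVlt; apply/orP; left; apply/eqP; congr (`| _ |); field.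
  by apply: DeriveDef; [apply/cvg_ex; exists d|exact: cvg_lim].
Qed.

(** Induction on a real segment: it replaces the extraction of a finite subcover, by
    looking at the supremum of the points satisfying [P]. *)
Lemma segment_induction (R : realType) (a b : R) (P : R -> Prop) :
  a <= b -> P a ->
  (forall x, a <= x <= b -> exists2 h : R, 0 < h &
     forall u v, a <= u <= x -> x <= v <= b -> x - h < u -> v < x + h -> P u -> P v) ->
  P b.
Proof.
move=> ab Pa H; pose S := [set s | a <= s <= b /\ P s].
have Sa : S a by split=> //; rewrite lexx.
have hS : has_sup S by split; [exists a|exists b => s [/andP[]]].
have ax : a <= sup S by apply: sup_upper_bound.
have xb : sup S <= b by apply: sup_le_ub; [exists a|move=> s [/andP[]]].
have [|h h0 Hh] := H (sup S); first by rewrite ax.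
have [u [/andP[au ub] Pu] xu] := sup_adherent h0 hS.
have ux : u <= sup S by apply: sup_upper_bound => //; split=> //; rewrite au.
have Pv : P (Num.min (sup S + h / 2) b).
  apply: Hh Pu => //; first by rewrite au.
    by rewrite le_min xb andbT ge_min lexx orbT andbT; lra.
  by rewrite gt_min; apply/orP; left; lra.
have : Num.min (sup S + h / 2) b <= sup S.
  apply: sup_upper_bound => //; split=> //.
  by rewrite le_min ab andbT ge_min lexx orbT andbT; lra.
by rewrite ge_min => /orP[|bx]; [lra|move: Pv; rewrite min_r//; lra].
Qed.

Section ac.
Variable R : realType.
Implicit Types (f g : R -> R) (a b : R).
Local Notation mu := (@lebesgue_measure R).

Lemma abs_continuous_sub f a b a' b' : a <= a' -> b' <= b ->
  abs_continuous a b f -> abs_continuous a' b' f.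
Proof.
move=> aa bb H e e0; have [d d0 Hd] := H e e0; exists d => // m l r lr.
by apply: Hd => k; have [] := lr k; split=> //; lra.
Qed.

Lemma abs_continuousB_linear f a b c :
  abs_continuous a b f -> abs_continuous a b (fun t => f t - c * t).
Proof.
move=> H e e0; have e2 : 0 < e / 2 by lra.
have [d d0 Hd] := H _ e2.
have c0 : 0 < `|c| + 1 by rewrite ltr_wpDl.
exists (Num.min d (e / 2 / (`|c| + 1))); first by rewrite lt_min d0 divr_gt0.
move=> m l r lr dis; rewrite lt_min => /andP[s1 s2].
have H1 := Hd m l r lr dis s1.
apply: (@le_lt_trans _ _ (\sum_(k < m) (`|f (r k) - f (l k)| + `|c| * (r k - l k)))).
  apply: ler_sum => k _; have [_ lk _] := lr k.
  have -> : f (r k) - c * r k - (f (l k) - c * l k) =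
      (f (r k) - f (l k)) - c * (r k - l k) by ring.
  by rewrite (le_trans (ler_normB _ _))// normrM (ger0_norm (_ : 0 <= r k - l k))// subr_ge0.
rewrite big_split /= -mulr_sumr.
have S0 : 0 <= \sum_(k < m) (r k - l k).
  by apply: sumr_ge0 => k _; have [_ lk _] := lr k; rewrite subr_ge0.
rewrite ltr_pdivlMr// in s2.
have : `|c| * (\sum_(k < m) (r k - l k)) <= (\sum_(k < m) (r k - l k)) * (`|c| + 1).
  by rewrite mulrC ler_wpM2l// lerDl.
lra.
Qed.

Lemma abs_continuous_dist f a b e : abs_continuous a b f -> 0 < e ->
  exists2 d : R, 0 < d & forall x y, a <= x <= b -> a <= y <= b -> `|x - y| < d ->
    `|f x - f y| < e.
Proof.
move=> H e0; have [d d0 Hd] := H e e0; exists d => // x y.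
wlog xy : x y / x <= y.
  move=> W hx hy; have [xy|/ltW xy] := leP x y; first exact: W.
  by rewrite distrC (distrC (f x)); exact: W.
move=> /andP[ax xb] /andP[ay yb] xyd.
have := Hd 1%N (fun=> x) (fun=> y); rewrite !big_ord1 distrC; apply.
- by [].
- by move=> j k; rewrite !ord1 eqxx.
- by rewrite -(ger0_norm (_ : 0 <= y - x)) ?subr_ge0// distrC.
Qed.

Lemma lipschitz_abs_continuous f a b L : 0 < L ->
  (forall x y, a <= x <= b -> a <= y <= b -> x <= y -> `|f y - f x| <= L * (y - x)) ->
  abs_continuous a b f.
Proof.
move=> L0 H e e0; exists (e / L); first by rewrite divr_gt0.
move=> m l r lr _; rewrite ltr_pdivlMr// => Hs.
apply: le_lt_trans Hs; rewrite mulrC mulr_sumr; apply: ler_sum => k _.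
by have [al lk rb] := lr k; apply: H => //; rewrite ?al ?rb; lra.
Qed.

Lemma ae_imply (P Q : R -> Prop) : (forall t, P t -> Q t) ->
  {ae mu, forall t, P t} -> {ae mu, forall t, Q t}.
Proof.
move=> PQ [A [mA A0 HA]]; exists A; split=> // t nQ; apply: HA => Pt.
exact/nQ/PQ.
Qed.

(** The exceptional null set and both endpoints are put in an open set of small
    measure, so that everywhere else [P] holds at an interior point. *)
Lemma ae_cover a b (P : R -> Prop) (d : R) : 0 < d ->
  {ae mu, forall t, t \in `]a, b[ -> P t} ->
  exists U : set R, [/\ open U, (mu U < d%:E)%E &
    forall x, a <= x <= b -> U x \/ (a < x < b /\ P x)].
Proof.
move=> d0 [A [mA A0 HA]].
have mB : measurable (A `|` [set a; b]).
  by apply: measurableU => //; apply: measurableU; exact: measurable_set1.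
have B0 : mu (A `|` [set a; b]) = 0%E.
  have mab : measurable ([set a; b] : set R) by apply: measurableU; exact: measurable_set1.
  have le1 : (mu (A `|` [set a; b]) <= mu A + mu [set a; b])%E by exact: measureU2.
  have le2 : (mu [set a; b] <= mu [set a] + mu [set b])%E.
    by apply: measureU2; exact: measurable_set1.
  apply/eqP; rewrite eq_le measure_ge0 andbT (le_trans le1)// A0 add0e (le_trans le2)//.
  by rewrite !lebesgue_measure_set1 adde0.
have Boo : (mu (A `|` [set a; b]) < +oo)%E by rewrite B0; exact: ltry.
have [U [oU BU UB]] := @lebesgue_regularity_outer R _ d mB Boo d0.
exists U; split => //.
  have mD : measurable (U `\` (A `|` [set a; b])).
    by apply: measurableD => //; exact: measurable_realfun.open_measurable.
  have le1 : (mu ((A `|` [set a; b]) `|` (U `\` (A `|` [set a; b]))) <=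
    mu (A `|` [set a; b]) + mu (U `\` (A `|` [set a; b])))%E by exact: measureU2.
  by rewrite -(setDUK BU) (le_lt_trans le1)// B0 add0e.
move=> x /andP[ax xb]; have [Ux|nUx] := pselect (U x); [by left|right].
have [xa|xa] := eqVneq x a; first by exfalso; apply: nUx; apply: BU; right; left.
have [xb'|xb'] := eqVneq x b; first by exfalso; apply: nUx; apply: BU; right; right.
have xab : a < x < b by rewrite !lt_neqAle ax xb xb' eq_sym xa.
split => //; apply: contrapT => nP; apply: nUx; apply: BU; left; apply: HA => /= /(_ _)/nP; apply.
by rewrite in_itv.
Qed.

Lemma measure_open_segment (U : set R) a b : open U -> (mu U < +oo)%E ->
  [/\ measurable (U `&` `[a, b]%classic), (mu (U `&` `[a, b]%classic) <= mu U)%E &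
      mu (U `&` `[a, b]%classic) \is a fin_num].
Proof.
move=> oU Uoo; have mU := measurable_realfun.open_measurable oU.
have mUI : measurable (U `&` `[a, b]%classic).
  by apply: measurableI => //; exact: measurable_itv.
have leU : (mu (U `&` `[a, b]%classic) <= mu U)%E.
  by apply: le_measure; rewrite ?inE//; exact: subIsetl.
by split => //; rewrite ge0_fin_numE ?measure_ge0//; exact: le_lt_trans Uoo.
Qed.

Lemma measure_open_step (U : set R) a u v : open U -> a <= u -> u <= v ->
  (forall x, u <= x <= v -> U x) -> (mu U < +oo)%E ->
  fine (mu (U `&` `[a, u]%classic)) + (v - u) <= fine (mu (U `&` `[a, v]%classic)).
Proof.
move=> oU au uv uvU Uoo.
have [mUu _ fUu] := measure_open_segment a u oU Uoo.
have [mUv _ fUv] := measure_open_segment a v oU Uoo.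
have mIo : measurable `]u, v]%classic by exact: measurable_itv.
have E : (mu (U `&` `[a, u]%classic) + mu `]u, v]%classic <= mu (U `&` `[a, v]%classic))%E.
  have dsj : (U `&` `[a, u]%classic) `&` `]u, v]%classic = set0.
    apply/seteqP; split => // x [[_ /=]]; rewrite !in_itv /= => /andP[_ xu] /andP[ux _]; lra.
  have <- : (mu ((U `&` `[a, u]%classic) `|` `]u, v]%classic) =
      mu (U `&` `[a, u]%classic) + mu `]u, v]%classic)%E.
    exact: measureU.
  apply: le_measure; rewrite ?inE//; first exact: measurableU.
  move=> x [[Ux]|] /=; rewrite !in_itv /= => /andP[h1 h2].
    by split=> //=; rewrite h1 (le_trans h2).
  by split=> /=; [apply: uvU; rewrite (ltW h1)|rewrite h2 andbT (le_trans au)// ltW].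
rewrite -lee_fin EFinD !fineK//; apply: le_trans E; rewrite leeD2l//.
rewrite lebesgue_measure_itv /= lte_fin; case: ltP => //; rewrite lee_fin; lra.
Qed.

(** Walk from [a] to [b], collecting disjoint intervals inside a small open set [U]
    that contains the bad points.  Near a point outside [U] the increment of [f] is
    controlled by the derivative; near a point of [U] the step is added to the
    collection.  The collected intervals have total length at most the measure
    of [U], so absolute continuity bounds their contribution to the increment.
    Keeping the length below the measure of [U] to the left of the current
    point is what makes the collection extensible. *)
Lemma abs_continuous_mean_value f a b M : a <= b -> 0 <= M -> abs_continuous a b f ->
  {ae mu, forall t, t \in `]a, b[ -> exists2 d : R, is_derive t 1 f d & `|d| <= M} ->
  `|f b - f a| <= M * (b - a).
Proof.
move=> ab M0 acf aef; apply/ler_addgt0Pr => e0 e00.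
pose e := e0 / (b - a + 1).
have ba1 : 0 < b - a + 1 by lra.
have e_gt0 : 0 < e by rewrite divr_gt0.
suff : `|f b - f a| <= (M + e) * (b - a) + e.
  have -> : e0 = e * (b - a + 1) by rewrite /e divfK// gt_eqF.
  by lra.
have [d d0 Hd] := acf e e_gt0.
have [U [oU Ud HU]] := ae_cover d0 aef.
have Uoo : (mu U < +oo)%E by apply: lt_trans Ud (ltry _).
pose W s := fine (mu (U `&` `[a, s]%classic)).
(* [fam s m l r]: disjoint intervals to the left of [s] that account for the part of
   the increment [f s - f a] not controlled by the slope [M + e]. *)
pose fam s (m : nat) (l r : 'I_m -> R) :=
  [/\ forall k, [/\ a <= l k, l k <= r k & r k <= s],
      forall j k, j != k -> r j <= l k \/ r k <= l j,
      \sum_(k < m) (r k - l k) <= W s &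
      `|f s - f a| <= (M + e) * (s - a) + \sum_(k < m) `|f (r k) - f (l k)|].
have [m [l [r [lr dis sW fba]]]] : exists m l r, @fam b m l r.
  apply: (@segment_induction _ a b (fun s => exists m l r, @fam s m l r)) => //.
    exists 0%N, (fun=> 0), (fun=> 0); split => //; [by case|by case| |].
      by rewrite big_ord0 fine_ge0// measure_ge0.
    by rewrite big_ord0 !subrr normr0 mulr0 addr0.
  move=> x xab.
  have [Ux|[/andP[ax xb] [D fD DM]]] := HU x xab.
    have /nbhs_ballP[h /= h0 Hh] : nbhs x U by apply: open_nbhs_nbhs.
    exists h => // u v /andP[au ux] /andP[xv vb] hu hv [m [l [r [lr dis sW fsa]]]].
    have uvU y : u <= y <= v -> U y.
      by move=> /andP[uy yv]; apply: Hh; rewrite /ball /= ltr_norml; lra.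
    have uv : u <= v by lra.
    have WW := measure_open_step oU au uv uvU Uoo.
    exists m.+1, (fun k => if unlift ord0 k is Some j then l j else u),
      (fun k => if unlift ord0 k is Some j then r j else v); split.
    - move=> k; case: unliftP => [j _|_]; last by split.
      by have [? ? ?] := lr j; split => //; lra.
    - move=> j k; case: unliftP => [j' ->|->]; case: unliftP => [k' ->|->] jk.
      + by apply: dis; apply: contraNneq jk => ->.
      + by left; have [] := lr j'.
      + by right; have [] := lr k'.
      + by rewrite eqxx in jk.
    - rewrite big_ord_recl unlift_none.
      under eq_bigr do rewrite liftK.
      by rewrite addrC; apply: le_trans WW; rewrite lerD2r.
    - rewrite big_ord_recl unlift_none.
      under eq_bigr do rewrite liftK.
      have -> : f v - f a = (f v - f u) + (f u - f a) by ring.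
      have Mu : (M + e) * (u - a) <= (M + e) * (v - a).
        by rewrite ler_wpM2l//; lra.
      have := ler_normD (f v - f u) (f u - f a); lra.
  have [h h0 Hh] := (is_derive_bound f x D).1 fD e e_gt0.
  exists h => // u v /andP[au ux] /andP[xv vb] hu hv [m [l [r [lr dis sW fsa]]]].
  exists m, l, r; split => //.
  - by move=> k; have [? ? ?] := lr k; split => //; lra.
  - have [mUu _ fUu] := measure_open_segment a u oU Uoo.
    have [mUv _ fUv] := measure_open_segment a v oU Uoo.
    apply: (le_trans sW); apply: fine_le => //; apply: le_measure; rewrite ?inE//.
    by move=> y [Uy] /=; rewrite !in_itv /= => /andP[ay yu]; split => //=; rewrite ay; lra.
  - have Hlip y : `|y - x| < h -> `|f y - f x| <= (M + e) * `|y - x|.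
      move=> /Hh H; have := ler_normD (f y - f x - D * (y - x)) (D * (y - x)).
      rewrite subrK normrM => H2; apply: (le_trans H2); rewrite addrC mulrDl lerD//.
      by rewrite ler_wpM2r.
    have hx : `|v - x| < h by rewrite ger0_norm; lra.
    have := Hlip v hx; have hu' : `|u - x| < h by rewrite ler0_norm; lra.
    have := Hlip u hu'; rewrite (ler0_norm (_ : u - x <= 0)) ?subr_le0//.
    rewrite (ger0_norm (_ : 0 <= v - x)) ?subr_ge0// (distrC (f u)) => H1 H2.
    have -> : f v - f a = (f v - f x) + ((f x - f u) + (f u - f a)) by ring.
    have := ler_normD (f v - f x) ((f x - f u) + (f u - f a)).
    have := ler_normD (f x - f u) (f u - f a).
    have -> : (M + e) * (v - a) =
      (M + e) * (v - x) + (M + e) * (- (u - x)) + (M + e) * (u - a) by ring.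
    lra.
apply: (le_trans fba); rewrite lerD2l; apply/ltW/Hd => //.
have [_ leU fU] := measure_open_segment a b oU Uoo.
by apply: le_lt_trans sW _; rewrite -lte_fin fineK//; exact: le_lt_trans Ud.
Qed.

(** The mean value inequality applied to [f t - g x * t] on small intervals around
    [x], where the almost everywhere derivative [g t - g x] is small. *)
Lemma abs_continuous_is_derive f g a b x : abs_continuous a b f ->
  {ae mu, forall t, t \in `]a, b[ -> is_derive t 1 f (g t)} ->
  a < x < b -> {for x, continuous g} -> is_derive x 1 f (g x).
Proof.
move=> acf aef /andP[ax xb] cg; apply/is_derive_bound => e e0.
have /cvgrPdist_le/(_ e e0) /nbhs_ballP[h0 /= h00 Hh] := cg.
pose h := Num.min h0 (Num.min (x - a) (b - x)).
have h_gt0 : 0 < h by rewrite !lt_min h00 !subr_gt0 ax.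
exists h => // y; rewrite !lt_min => /andP[yh /andP[ya yb]].
suff W u v : u <= v -> `|u - x| < h -> `|v - x| < h ->
    `|f v - f u - g x * (v - u)| <= e * (v - u).
  have h1 : `|y - x| < h by rewrite !lt_min yh ya.
  have h2 : `|x - x| < h by rewrite subrr normr0.
  have [xy|/ltW yx] := leP x y.
    by rewrite (ger0_norm (_ : 0 <= y - x)) ?subr_ge0//; exact: W.
  rewrite (ler0_norm (_ : y - x <= 0)) ?subr_le0// -normrN opprB.
  have -> : g x * (y - x) - (f y - f x) = f x - f y - g x * (x - y) by ring.
  by rewrite opprB; exact: W.
move=> uv; rewrite !lt_min => /andP[uh /andP[ua ub]] /andP[vh /andP[va vb]].
have := @abs_continuous_mean_value (fun t => f t - g x * t) u v e uv (ltW e0).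
have -> : f v - g x * v - (f u - g x * u) = f v - f u - g x * (v - u) by ring.
apply.
  apply: (@abs_continuous_sub _ a b).
  - by move: ua; rewrite ltr_norml; lra.
  - by move: vb; rewrite ltr_norml; lra.
  - exact: abs_continuousB_linear.
apply: ae_imply aef => t Ht tuv; move: tuv; rewrite in_itv /= => /andP[ut tv].
have tab : t \in `]a, b[.
  by rewrite in_itv /=; move: ua ub va vb; rewrite !ltr_norml; lra.
exists (g t - g x).
  have Ht' := Ht tab.
  have : is_derive t 1 (fun t => f t - g x *: t) (g t - g x *: 1) by apply: is_deriveB.
  by rewrite [_ *: 1]mulr1.
rewrite distrC; apply: Hh; rewrite /ball /= distrC.
by move: uh vh; rewrite !ltr_norml; lra.
Qed.

(** Freezing [f] outside the segment gives a function continuous on the whole line,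
    to which continuity lemmas apply without restriction to a subspace. *)
Lemma abs_continuous_clamp f a b : a <= b -> abs_continuous a b f ->
  continuous (fun t => f (Num.max a (Num.min t b))).
Proof.
move=> ab acf x; apply/cvgrPdist_lt => e e0.
have [d d0 Hd] := abs_continuous_dist acf e0.
apply/nbhs_ballP; exists d => //= y xy; apply: Hd.
- by rewrite le_max lexx ge_max ab ge_min lexx orbT.
- by rewrite le_max lexx ge_max ab ge_min lexx orbT.
- apply: le_lt_trans xy; rewrite ler_norml.
  have := ler_norm (x - y); have := ler_norm (- (x - y)); rewrite normrN.
  by case: (leP x b); case: (leP y b); case: (leP a x); case: (leP a y); case: (leP a b); lra.
Qed.

End ac.

(** * Linear systems with constant coefficients *)

Section linear_systems.
Variable R : realType.

Lemma continuous_sum (I : finType) (F : I -> R -> R) :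
  (forall i, continuous (F i)) -> continuous (fun t => \sum_i F i t).
Proof. by move=> cF; apply: continuous_big => //; exact: add_continuous. Qed.

Lemma is_derive_mulmx (m n : nat) (M : 'M[R]_(m, n)) (w : 'cV[R]_m) (X : R -> 'cV[R]_n)
    (t : R) (d : 'cV[R]_n) (i : 'I_m) :
  (forall j, is_derive t 1 (fun r => X r j 0) (d j 0)) ->
  is_derive t 1 (fun r => (M *m X r + w) i 0) ((M *m d) i 0).
Proof.
move=> dX; have -> : (fun r => (M *m X r + w) i 0) =
    \sum_j (fun r => M i j *: X r j 0) + cst (w i 0).
  by apply/funext => r; rewrite /= !mxE fct_sumE.
rewrite mxE -[X in is_derive _ _ _ X]addr0.
exact: is_deriveD.
Qed.

Lemma continuous_mulmx (m n : nat) (M : 'M[R]_(m, n)) (w : 'cV[R]_m) (X : R -> 'cV[R]_n)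
    (i : 'I_m) :
  (forall j, continuous (fun r => X r j 0)) -> continuous (fun r => (M *m X r + w) i 0).
Proof.
move=> cX; have -> : (fun r => (M *m X r + w) i 0) =
    (fun r => \sum_j M i j * X r j 0 + w i 0).
  by apply/funext => r; rewrite /= !mxE.
move=> r; apply: cvgD; last exact: cvg_cst.
by apply: continuous_sum => j s; apply: cvgMr; exact: cX.
Qed.

(** Classical solutions from rest of the system with matrix [M] and constant forcing
    [w]; continuity is asked on the whole line, the equation inside [(0, T)]. *)
Definition lti_solution (n : nat) (M : 'M[R]_n) (w : 'cV[R]_n) (T : R)
    (X : R -> 'cV[R]_n) : Prop :=
  [/\ X 0 = 0, forall i, continuous (fun t => X t i 0) &
      forall t, 0 < t < T -> forall i,
        is_derive t 1 (fun r => X r i 0) ((M *m X t + w) i 0)].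

Lemma zero_derivative_const (f : R -> R) (T t : R) : continuous f ->
  (forall s, 0 < s < T -> is_derive s 1 f 0) -> 0 <= t <= T -> f t = f 0.
Proof.
move=> cf df /andP[t0 tT].
have [|_ _] := @MVT_segment R f (fun=> 0) 0 t t0 _ (continuous_subspaceT cf).
  by move=> s; rewrite in_itv /= => /andP[s0 st]; apply: df; rewrite s0 (lt_le_trans st).
by rewrite mul0r => /eqP; rewrite subr_eq0 => /eqP.
Qed.

Lemma pairing_trmx (n : nat) (M : 'M[R]_n) (p q : 'cV[R]_n) :
  \sum_i q i 0 * (M *m p) i 0 = \sum_i p i 0 * (M^T *m q) i 0.
Proof.
under eq_bigr do rewrite mxE mulr_sumr.
rewrite exchange_big /=; apply: eq_bigr => j _; rewrite mxE mulr_sumr.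
by apply: eq_bigr => i _; rewrite mxE; ring.
Qed.

(** The velocities [p s = M X1 s + w1] and [q s = M^T X2 s + w2] solve [p' = M p] and
    [q' = M^T q], so [q (t - s)^T p s] has zero derivative in [s]; the two sides are
    its values at [s = t] and [s = 0], since [q 0 = w2] and [p 0 = w1]. *)
Lemma lti_duality (n : nat) (M : 'M[R]_n) (w1 w2 : 'cV[R]_n) (T : R)
    (X1 X2 : R -> 'cV[R]_n) (t : R) :
  lti_solution M w1 T X1 -> lti_solution M^T w2 T X2 -> 0 <= t <= T ->
  (w2^T *m (M *m X1 t + w1)) 0 0 = (w1^T *m (M^T *m X2 t + w2)) 0 0.
Proof.
move=> [X10 cX1 dX1] [X20 cX2 dX2] tT.
pose p s := M *m X1 s + w1; pose q s := M^T *m X2 s + w2.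
have cp i : continuous (fun s => p s i 0) by exact: continuous_mulmx.
have cq i : continuous (fun s => q s i 0) by exact: continuous_mulmx.
have dp s : 0 < s < T -> forall i, is_derive s 1 (fun s => p s i 0) ((M *m p s) i 0).
  by move=> sT i; apply: is_derive_mulmx => j; exact: dX1.
have dq s : 0 < s < T -> forall i, is_derive s 1 (fun s => q s i 0) ((M^T *m q s) i 0).
  by move=> sT i; apply: is_derive_mulmx => j; exact: dX2.
pose G s := \sum_i q (t - s) i 0 * p s i 0.
have cG : continuous G.
  apply: continuous_sum => i s; apply: cvgM; last exact: cp.
  apply: (@cvg_comp _ _ _ (fun s => t - s) (fun s => q s i 0)); last exact: cq.
  by apply: cvgB; [exact: cvg_cst|exact: cvg_id].
have dG s : 0 < s < t -> is_derive s 1 G 0.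
  move=> st; have -> : G = \sum_i (fun s => q (t - s) i 0 * p s i 0).
    by apply/funext => r; rewrite fct_sumE.
  have sT : 0 < s < T by move: tT st; lra.
  have tsT : 0 < t - s < T by move: tT st; lra.
  have -> : 0 = \sum_i (q (t - s) i 0 * (M *m p s) i 0 + p s i 0 * - (M^T *m q (t - s)) i 0) :> R.
    rewrite big_split /= -[RHS]addr0.
    have -> : \sum_i q (t - s) i 0 * (M *m p s) i 0 = \sum_i p s i 0 * (M^T *m q (t - s)) i 0.
      exact: pairing_trmx.
    by rewrite -big_split /= big1 ?addr0// => i _; rewrite mulrN subrr.
  apply: is_derive_sum => i; apply: is_deriveM; last exact: dp.
  have := dq _ tsT i => dqi.
  have dts : is_derive s 1 (fun s => t - s) (- 1 : R).
    have -> : (-1 : R) = 0 - 1 by rewrite sub0r.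
    exact: is_deriveB.
  have := @is_derive1_comp R (fun s => q s i 0) (fun s => t - s) s _ _ dqi dts.
  by rewrite mulrN1.
have t0 : 0 <= t <= t by rewrite lexx andbT; case/andP: tT.
have := zero_derivative_const cG dG t0.
rewrite /G subrr subr0 {2}/p {1}/q X10 X20 !mulmx0 !add0r.
move=> E; rewrite [LHS]mxE [RHS]mxE.
transitivity (\sum_i w2 i 0 * (M *m X1 t + w1) i 0); first by apply: eq_bigr => i _; rewrite mxE.
by rewrite E; apply: eq_bigr => i _; rewrite [w1^T _ _]mxE mulrC.
Qed.

(** Gronwall: the squared norm [phi] satisfies [phi' <= K phi], so [exp (- K s) phi s]
    is nonincreasing, and it starts from 0. *)
Lemma lti_solution_uniq0 (n : nat) (M : 'M[R]_n) (T t : R) (X : R -> 'cV[R]_n) :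
  lti_solution M 0 T X -> 0 <= t <= T -> X t = 0.
Proof.
move=> [X0 cX dX] /andP[t0 tT].
pose phi s := \sum_i X s i 0 * X s i 0.
(* [K] majorizes twice the quadratic form of [M], by [2 |x y| <= x ^ 2 + y ^ 2]. *)
pose K := 2 * \sum_i \sum_j `|M i j|.
pose dphi s := \sum_i (X s i 0 * (M *m X s + 0) i 0 + X s i 0 * (M *m X s + 0) i 0).
have phi_ge0 s : 0 <= phi s by apply: sumr_ge0 => i _; rewrite -expr2 sqr_ge0.
have Xphi s i : X s i 0 ^+ 2 <= phi s.
  by rewrite /phi (bigD1 i)//= -expr2 lerDl sumr_ge0// => j _; rewrite -expr2 sqr_ge0.
have dphiK s : dphi s <= K * phi s.
  rewrite /dphi /K -mulrA mulr_suml mulr_sumr; apply: ler_sum => i _.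
  rewrite addr0 -mulr2n -[leLHS]mulr_natl ler_wpM2l// mxE mulr_sumr mulr_suml.
  apply: ler_sum => j _.
  apply: le_trans (ler_norm _) _; rewrite !normrM mulrCA ler_wpM2l//.
  rewrite -(@ler_pM2l _ 2)//; have := Xphi s i; have := Xphi s j.
  rewrite -(real_normK (num_real (X s i 0))) -(real_normK (num_real (X s j 0))).
  have := sqr_ge0 (`|X s i 0| - `|X s j 0|); nra.
pose psi (s : R) := expR (- K * s) * phi s.
pose dpsi (s : R) := expR (- K * s) * dphi s + phi s * (- K * expR (- K * s)).
have cphi : continuous phi by apply: continuous_sum => i s; apply: cvgM; exact: cX.
have dE (s : R) : is_derive s 1 (fun s : R => expR (- K * s)) (- K * expR (- K * s)).
  have dK : is_derive s 1 (fun s : R => - K *: s) (- K *: 1) by exact: is_deriveZ.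
  have := @is_derive1_comp R expR (fun s => - K * s) s _ _ (is_derive_expR _) dK.
  by rewrite [_ *: 1]mulr1 mulrC.
have cpsi : continuous psi.
  move=> s; apply: cvgM; last exact: cphi.
  apply: (@continuous_comp _ _ _ (fun s : R => - K * s) expR).
    exact: mulrl_continuous.
  exact: continuous_expR.
have d_psi s : 0 < s < T -> is_derive s 1 psi (dpsi s).
  move=> sT; apply: is_deriveM.
  have -> : phi = \sum_i (fun s => X s i 0 * X s i 0) by apply/funext => r; rewrite fct_sumE.
  by apply: is_derive_sum => i; apply: is_deriveM; exact: dX.
have [|c _] := @MVT_segment R psi dpsi 0 t t0 _ (continuous_subspaceT cpsi).
  by move=> s; rewrite in_itv /= => /andP[s0 st]; apply: d_psi; rewrite s0 (lt_le_trans st).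
have dpsi_le0 : dpsi c <= 0.
  rewrite /dpsi; have := dphiK c; have := expR_gt0 (- K * c).
  by set E := expR _; nra.
have -> : psi 0 = 0 by rewrite /psi /phi X0 big1 ?mulr0// => i _; rewrite mxE mulr0.
rewrite !subr0 => psit; have phit : phi t <= 0.
  have : psi t <= 0 by rewrite psit mulr_le0_ge0.
  by rewrite /psi pmulr_rle0// expR_gt0.
apply/colP => i; rewrite mxE; apply/eqP; rewrite -sqrf_eq0 eq_le sqr_ge0 andbT.
exact: le_trans (Xphi t i) phit.
Qed.

End linear_systems.

(** * Responses of a system and of its dual to constant inputs *)

(** For a constant input the right-hand side of the equation is continuous in time,
    so the almost everywhere equation holds at each interior time. *)
Lemma constant_trajectory (R : realType) (n : nat) (s : system R n) (u : input R)
    (beta : R) (x : R -> 'cV[R]_n) :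
  (forall t, t \in `[0, duration u] -> u t = beta) -> is_trajectory s u x ->
  exists2 X : R -> 'cV[R]_n,
    lti_solution (sysA s + beta *: sysN s) (beta *: sysb s) (duration u) X &
    forall t, 0 <= t <= duration u -> X t = x t.
Proof.
move=> ub [x0 acx dx]; set T := duration u in ub acx dx *.
have T0 : 0 <= T := duration_ge0 u.
pose X t := x (Num.max 0 (Num.min t T)).
have Xx t : 0 <= t <= T -> X t = x t.
  by move=> /andP[t0 tT]; rewrite /X min_l// max_r.
have cX i : continuous (fun t => X t i 0).
  exact: (abs_continuous_clamp T0 (acx i)).
exists X => //; split => //; first by rewrite Xx ?lexx.
move=> t tT i; pose g r := ((sysA s + beta *: sysN s) *m X r + beta *: sysb s) i 0.
have dg : is_derive t 1 (fun r => x r i 0) (g t).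
  apply: (abs_continuous_is_derive (acx i)) => //; last exact: continuous_mulmx.
  apply: ae_imply dx => r dxr rT; have := dxr rT i.
  have rT' : 0 <= r <= T by move: rT; rewrite in_itv /=; lra.
  by rewrite ub ?in_itv// /g Xx.
apply: near_eq_is_derive dg.
have tI : t \in `]0, T[ by rewrite in_itv.
near=> r; rewrite Xx//.
have : r \in `]0, T[ by near: r; exact: near_in_itvoo.
by rewrite in_itv /=; lra.
Unshelve. all: by end_near. Qed.

Definition dual_system (R : realType) (n : nat) (s : system R n) : system R n :=
  System (sysA s)^T (sysN s)^T (sysc s)^T (sysb s)^T.

(** For [beta <> 0] duality of the velocities says that both outputs have the same
    derivative; they agree at time 0.  For [beta = 0] both outputs are zero. *)
Lemma dual_io_equiv_constant (R : realType) (n : nat) (s : system R n) :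
  io_equiv_under (@constant_input R) s (dual_system s).
Proof.
move=> u [beta ub] y1 y2 [x1 tr1 xy1] [x2 tr2 xy2] t tT.
have tT' : 0 <= t <= duration u by move: tT; rewrite in_itv.
have [X1 S1 E1] := constant_trajectory ub tr1.
have [X2 S2 E2] := constant_trajectory ub tr2.
rewrite xy1// xy2// -E1// -E2//.
have [b0|b0] := eqVneq beta 0.
  move: S1 S2; rewrite b0 !scale0r !addr0 => S1 S2.
  by rewrite (lti_solution_uniq0 S1)// (lti_solution_uniq0 S2)// !mulmx0 !mxE.
move: S2; rewrite /= -linearZ -linearD -linearZ => S2.
pose f r := (sysc s *m X1 r + 0) 0 0 - ((sysb s)^T *m X2 r + 0) 0 0.
have [X10 cX1 dX1] := S1; have [X20 cX2 dX2] := S2.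
have cf : continuous f.
  by move=> r; apply: cvgB; apply: continuous_mulmx.
have df r : 0 < r < duration u -> is_derive r 1 f 0.
  move=> rT; have rT' : 0 <= r <= duration u by move: rT; lra.
  have := lti_duality S1 S2 rT'; rewrite !linearZ /= trmxK -!scalemxAl mxE [RHS]mxE.
  move=> /(mulfI b0) E.
  have -> : 0 = (sysc s *m ((sysA s + beta *: sysN s) *m X1 r + beta *: sysb s)) 0 0 -
     ((sysb s)^T *m ((sysA s + beta *: sysN s)^T *m X2 r + (beta *: sysc s)^T)) 0 0.
    rewrite E; apply/esym/eqP; rewrite subr_eq0; apply/eqP; congr ((_ *m _) 0 0).
    by rewrite [(beta *: sysc s)^T]linearZ.
  by apply: is_deriveB; apply: is_derive_mulmx => j; [exact: dX1|exact: dX2].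
have := zero_derivative_const cf df tT'.
have -> : f 0 = 0 by rewrite /f X10 X20 !mulmx0 !addr0 !mxE subrr.
by rewrite /f !addr0 => /eqP; rewrite subr_eq0 => /eqP.
Qed.

(** * Sums of power series *)

Section power_series.
Variable R : realType.
Implicit Types (f g d : nat -> R) (t B C : R).

Definition pseries_sum f t (l : R) := pseries f t @ \oo --> l.

Lemma pseries_sumD f g t a b : pseries_sum f t a -> pseries_sum g t b ->
  pseries_sum (fun k => f k + g k) t (a + b).
Proof.
move=> fa gb; rewrite /pseries_sum.
have -> : pseries (fun k => f k + g k) t = pseries f t \+ pseries g t.
  by apply/funext => n; rewrite /pseries /series /= -big_split;
    apply: eq_bigr => k _; rewrite mulrDl.
exact: cvgD.
Qed.

Lemma pseries_sumZ c f t a : pseries_sum f t a -> pseries_sum (fun k => c * f k) t (c * a).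
Proof.
move=> fa; rewrite /pseries_sum.
have -> : pseries (fun k => c * f k) t = (fun n => c * pseries f t n).
  by apply/funext => n; rewrite /pseries /series /= mulr_sumr;
    apply: eq_bigr => k _; rewrite mulrA.
exact: cvgMr.
Qed.

Lemma pseries_sum_sum (n : nat) (F : 'I_n -> nat -> R) t (a : 'I_n -> R) :
  (forall j, pseries_sum (F j) t (a j)) ->
  pseries_sum (fun k => \sum_j F j k) t (\sum_j a j).
Proof.
move=> Fa; rewrite /pseries_sum.
have -> : pseries (fun k => \sum_j F j k) t = (fun m => \sum_j pseries (F j) t m).
  apply/funext => m; rewrite /pseries /series /= exchange_big /=.
  by apply: eq_bigr => k _; rewrite mulr_suml.
by apply: cvg_big => [|j _]; [exact: add_continuous|exact: Fa].
Qed.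

Lemma pseriesS f t n : pseries f t n.+1 = f 0%N + t * pseries (fun k => f k.+1) t n.
Proof.
rewrite /pseries /series /= big_nat_recl// expr0 mulr1; congr (_ + _).
by rewrite mulr_sumr; apply: eq_bigr => k _; rewrite exprS mulrCA.
Qed.

Lemma pseries_sum_shift f t a : pseries_sum (fun k => f k.+1) t a ->
  pseries_sum f t (f 0%N + t * a).
Proof.
move=> fa; rewrite /pseries_sum -cvg_shiftS.
rewrite (_ : (fun n => _) = (fun n => f 0%N + t * pseries (fun k => f k.+1) t n)); last first.
  by apply/funext => n; rewrite /= pseriesS.
by apply: cvgD; [exact: cvg_cst|exact: cvgMr].
Qed.

Lemma pseries_sum_0 t : pseries_sum (fun=> 0) t 0.
Proof.
rewrite /pseries_sum (_ : pseries _ t = fun=> 0); first exact: cvg_cst.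
by apply/funext => n; rewrite /pseries /series /= big1// => k _; rewrite mul0r.
Qed.

Lemma pseries_sum_at0 f : pseries_sum f 0 (f 0%N).
Proof.
rewrite /pseries_sum -cvg_shiftS.
rewrite (_ : (fun n => _) = (fun n => f 0%N)); first exact: cvg_cst.
by apply/funext => n; rewrite /= pseriesS mul0r addr0.
Qed.

Definition geometric_bound f B C := forall k, `|f k| <= B * C ^+ k.

Lemma pseries_bounded f B C t n : 0 <= B -> 0 <= C -> geometric_bound f B C -> C * `|t| <= 2^-1 ->
  \sum_(0 <= k < n) `|f k * t ^+ k| <= 2 * B.
Proof.
move=> B0 C0 fB Ct.
suff H : \sum_(0 <= k < n) `|f k * t ^+ k| <= B * (2 - 2 * 2^-1 ^+ n).
  apply: (le_trans H); rewrite mulrC ler_wpM2r// gerBl mulr_ge0// exprn_ge0//; lra.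
elim: n => [|n IH]; first by rewrite big_nil expr0 mulr1 subrr mulr0.
rewrite big_nat_recr//=; have := IH.
have : `|f n * t ^+ n| <= B * 2^-1 ^+ n.
  rewrite normrM normrX; apply: (@le_trans _ _ (B * C ^+ n * `|t| ^+ n)).
    by rewrite ler_wpM2r// exprn_ge0.
  rewrite -mulrA ler_wpM2l// -exprMn lerXn2r ?nnegrE// ?mulr_ge0//.
by rewrite exprS; lra.
Qed.

Lemma pseries_cvg f B C t : 0 <= B -> 0 <= C -> geometric_bound f B C ->
  C * `|t| <= 2^-1 -> cvgn (pseries f t).
Proof.
move=> B0 C0 fB Ct; apply: normed_cvg; rewrite /normed_series_of /=.
apply: nondecreasing_is_cvgn.
  by apply: nondecreasing_series => k _ _.
exists (2 * B) => _ [n _ <-]; exact: pseries_bounded fB Ct.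
Qed.

Lemma pseries_lim_bounded f B C t : 0 <= B -> 0 <= C -> geometric_bound f B C ->
  C * `|t| <= 2^-1 -> `|limn (pseries f t)| <= 2 * B.
Proof.
move=> B0 C0 fB Ct; have cf := pseries_cvg B0 C0 fB Ct.
have cn : `|pseries f t n| @[n --> \oo] --> `|limn (pseries f t)| by apply: cvg_norm.
rewrite -(cvg_lim _ cn)//; apply: limr_le; first by apply/cvg_ex; exists `|limn (pseries f t)|.
near=> n; apply: le_trans (ler_norm_sum _ _ _) _; exact: pseries_bounded fB Ct.
Unshelve. all: by end_near. Qed.

(** The factor [k + 1] brought by differentiation is absorbed by [2 ^ k], at the cost
    of halving the radius of convergence. *)
Lemma geometric_bound_diffs f B C : 0 <= B -> 0 <= C -> geometric_bound f B C ->
  geometric_bound (pseries_diffs f) (B * C) (2 * C).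
Proof.
move=> B0 C0 fB k; rewrite /pseries_diffs normrM normr_nat.
have := fB k.+1; rewrite exprS exprMn => H.
have k2 : k.+1%:R <= 2 ^+ k :> R by rewrite -natrX ler_nat ltn_expl.
apply: (@le_trans _ _ (2 ^+ k * (B * (C * C ^+ k)))); first by apply: ler_pM.
by rewrite le_eqVlt; apply/orP; left; apply/eqP; ring.
Qed.

Lemma geometric_bound_shift f B C : geometric_bound f B C ->
  geometric_bound (fun k => f k.+1) (B * C) C.
Proof. by move=> fB k; rewrite -mulrA -exprS. Qed.

Lemma pseries_is_derive f B C t : 0 <= B -> 0 < C -> geometric_bound f B C ->
  `|t| < (8 * C)^-1 ->
  is_derive t 1 (fun t => limn (pseries f t)) (limn (pseries (pseries_diffs f) t)).
Proof.
move=> B0 C0 fB tC; have C0' := ltW C0.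
have fB1 := geometric_bound_diffs B0 C0' fB.
have fB2 : geometric_bound (pseries_diffs (pseries_diffs f)) (B * C * (2 * C)) (2 * (2 * C)).
  by apply: geometric_bound_diffs => //; rewrite mulr_ge0.
have K0 : 0 < (8 * C)^-1 by rewrite invr_gt0 mulr_gt0.
have CK : C * (8 * C)^-1 = 8^-1 by field; rewrite gt_eqF.
apply: (@pseries_snd_diffs _ _ (8 * C)^-1).
- apply: (pseries_cvg B0 C0' fB); rewrite gtr0_norm// CK; lra.
- apply: (pseries_cvg _ _ fB1); rewrite ?mulr_ge0// gtr0_norm// -mulrA CK; lra.
- apply: (pseries_cvg _ _ fB2); rewrite ?mulr_ge0// gtr0_norm// -!mulrA CK; lra.
- by rewrite (gtr0_norm K0).
Qed.

(** The sum is continuous at 0, where its value is [d 0]. *)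
Lemma pseries_vanish_head d B C T : 0 <= B -> 0 < C -> geometric_bound d B C -> 0 < T ->
  (forall t, 0 < t < T -> pseries_sum d t 0) -> d 0%N = 0.
Proof.
move=> B0 C0 dB T0 H.
have t0 : `|0 : R| < (8 * C)^-1 by rewrite normr0 invr_gt0 mulr_gt0.
have [D _] := pseries_is_derive B0 C0 dB t0.
move/derivable1_diffP/differentiable_continuous: D => cF.
apply/eqP; apply: contraT => d0; have nd0 : 0 < `|d 0%N| by rewrite normr_gt0.
have F0 : limn (pseries d 0) = d 0%N by apply/cvg_lim => //; exact: pseries_sum_at0.
have /cvgrPdist_lt/(_ _ nd0)/nbhs_ballP[h /= h0 Hh] := cF.
pose t := Num.min h T / 2.
have m0 : 0 < Num.min h T by rewrite lt_min h0.
have mT : Num.min h T <= T by rewrite ge_min lexx orbT.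
have mh : Num.min h T <= h by rewrite ge_min lexx.
have tT : 0 < t < T by rewrite /t; lra.
have th : ball (0 : R) h t.
  rewrite /ball /= sub0r normrN gtr0_norm; last by case/andP: tT.
  by rewrite /t; lra.
by have := Hh t th; rewrite F0 (cvg_lim _ (H t tT))// subr0 ltxx.
Qed.

(** Since [d 0 = 0], the sum is [t] times the sum of the shifted series, which therefore
    vanishes on a smaller interval; the shifted coefficients have the same
    growth rate. *)
Lemma pseries_vanish d B C T k : 0 <= B -> 0 < C -> geometric_bound d B C -> 0 < T ->
  (forall t, 0 < t < T -> pseries_sum d t 0) -> d k = 0.
Proof.
elim: k d B T => [|k IH] d B T B0 C0 dB T0 H; first exact: (pseries_vanish_head B0 C0 dB T0 H).
have d0 : d 0%N = 0 by exact: (pseries_vanish_head B0 C0 dB T0 H).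
have C2 : 0 < (2 * C)^-1 by rewrite invr_gt0 mulr_gt0.
apply: (IH (fun k => d k.+1) (B * C) (Num.min T (2 * C)^-1)) => //.
- by rewrite mulr_ge0// ltW.
- exact: geometric_bound_shift.
- by rewrite lt_min T0.
move=> t; rewrite lt_min => /andP[t0 /andP[tT tC]].
have Ct : C * `|t| <= 2^-1.
  rewrite (gtr0_norm t0); move: tC; rewrite invfM ltr_pdivlMr// => /ltW; lra.
have BC : 0 <= B * C by rewrite mulr_ge0// ltW.
have cl := pseries_cvg BC (ltW C0) (geometric_bound_shift dB) Ct.
have := pseries_sum_shift (cl : pseries_sum _ _ _); rewrite d0 add0r => dt.
have tT' : 0 < t < T by rewrite t0.
have /eqP : t * limn (pseries (fun k => d k.+1) t) = 0.
  by rewrite -(cvg_lim _ dt)// (cvg_lim _ (H t tT')).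
by rewrite mulf_eq0 gt_eqF//= => /eqP E; rewrite -E.
Qed.

End power_series.

(** * Power series solution for the input 1 + t *)

Section ramp.
Variables (R : realType).

(** Consecutive Taylor coefficients [(a k, a (k - 1))] of the trajectory for the input
    [1 + t], with [a (-1) = 0]: identifying the coefficients of [t ^ k] in
    [x' = (A + (1 + t) N) x + (1 + t) b] gives
    [(k + 1) a (k + 1) = (A + N) a k + N a (k - 1) + [k < 2] b]. *)
Fixpoint ramp_coefs (n : nat) (s : system R n) (k : nat) : 'cV[R]_n * 'cV[R]_n :=
  if k is k'.+1 then
    let: (a, a') := ramp_coefs s k' in
    (k'.+1%:R^-1 *: ((sysA s + sysN s) *m a + sysN s *m a' + (k' < 2)%N%:R *: sysb s), a)
  else (0, 0).

Definition ramp_coef (n : nat) (s : system R n) k := (ramp_coefs s k).1.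

Lemma ramp_coefs2 (n : nat) (s : system R n) k : (ramp_coefs s k.+1).2 = ramp_coef s k.
Proof. by rewrite /ramp_coef /=; case: (ramp_coefs s k). Qed.

Lemma ramp_coefS (n : nat) (s : system R n) k : ramp_coef s k.+1 =
  k.+1%:R^-1 *: ((sysA s + sysN s) *m ramp_coef s k + sysN s *m (ramp_coefs s k).2 +
                 (k < 2)%N%:R *: sysb s).
Proof. by rewrite /ramp_coef /=; case: (ramp_coefs s k). Qed.

Definition entry_sum (m n : nat) (M : 'M[R]_(m, n)) : R := \sum_i \sum_j `|M i j|.

Lemma entry_sum_ge0 (m n : nat) (M : 'M[R]_(m, n)) : 0 <= entry_sum M.
Proof. by apply: sumr_ge0 => i _; apply: sumr_ge0. Qed.

Lemma mulmx_entry_bound (m n : nat) (M : 'M[R]_(m, n)) (v : 'cV[R]_n) (K : R) i :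
  0 <= K -> (forall j, `|v j 0| <= K) -> `|(M *m v) i 0| <= entry_sum M * K.
Proof.
move=> K0 vK; rewrite mxE (le_trans (ler_norm_sum _ _ _))//.
apply: (@le_trans _ _ ((\sum_j `|M i j|) * K)).
  by rewrite mulr_suml; apply: ler_sum => j _; rewrite normrM ler_wpM2l.
rewrite ler_wpM2r// /entry_sum [leRHS](bigD1 i)//= lerDl; apply: sumr_ge0 => j _.
exact: sumr_ge0.
Qed.

(** A rate [C] for which the recursion preserves the bound [`|a k| <= C ^ k]. *)
Definition ramp_rate (n : nat) (s : system R n) : R :=
  1 + (entry_sum (sysA s + sysN s) + entry_sum (sysN s) + entry_sum (sysb s)).

Lemma ramp_rate_ge1 (n : nat) (s : system R n) : 1 <= ramp_rate s.
Proof. by rewrite lerDl !addr_ge0// entry_sum_ge0. Qed.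

Lemma ramp_coef_bound (n : nat) (s : system R n) (C : R) k i : ramp_rate s <= C ->
  `|ramp_coef s k i 0| <= C ^+ k.
Proof.
move=> sC; have C1 : 1 <= C := le_trans (ramp_rate_ge1 s) sC.
have C0 : 0 <= C by rewrite (le_trans _ C1).
suff: (forall i, `|ramp_coef s k i 0| <= C ^+ k) /\
    (forall i, `|(ramp_coefs s k).2 i 0| <= C ^+ k).
  by case.
elim: k {i} => [|k [IH1 IH2]]; first by split => i; rewrite /ramp_coef /= mxE normr0.
have Ck : 0 <= C ^+ k by rewrite exprn_ge0.
have Ck1 : 1 <= C ^+ k by rewrite exprn_ege1.
split => i; last first.
  by rewrite ramp_coefs2 (le_trans (IH1 i))// exprS ler_peMl.
rewrite ramp_coefS mxE normrM.
apply: (@le_trans _ _ (1 * (ramp_rate s * C ^+ k))); last by rewrite mul1r exprS ler_wpM2r.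
apply: ler_pM => //; first by rewrite ger0_norm ?invr_ge0// invf_le1 ?ler1n.
rewrite mxE [X in `|X + _|]mxE.
have H1 := mulmx_entry_bound (sysA s + sysN s) i Ck IH1.
have H2 := mulmx_entry_bound (sysN s) i Ck IH2.
have H3 : `|((k < 2)%N%:R *: sysb s) i 0| <= entry_sum (sysb s) * C ^+ k.
  apply: (@le_trans _ _ (entry_sum (sysb s))); last by rewrite ler_peMr// entry_sum_ge0.
  rewrite mxE normrM; apply: (@le_trans _ _ (1 * `|sysb s i 0|)).
    by rewrite ler_wpM2r// normr_nat; case: (_ < _)%N.
  rewrite mul1r /entry_sum (bigD1 i)//= big_ord1 lerDl.
  by apply: sumr_ge0 => j _; apply: sumr_ge0.
rewrite /ramp_rate !mulrDl mul1r.
apply: le_trans (ler_normD _ _) _.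
have := ler_normD (((sysA s + sysN s) *m ramp_coef s k) i 0)
  ((sysN s *m (ramp_coefs s k).2) i 0).
lra.
Qed.

Lemma ramp_measurable (T : R) :
  measurable_fun (`[0, T]%classic : set (lebesgueTypeR R)) (fun t : R => 1 + t).
Proof.
have sub (A : set R) : measurable A -> measurable (A : set (lebesgueTypeR R)).
  by move=> mA; apply: sub_caratheodory.
move=> _ Y mY; apply: sub.
have mf : measurable_fun (setT : set R) (fun t : R => 1 + t).
  by apply: measurable_realfun.measurable_funD; [exact: measurable_cst|exact: measurable_id].
by apply: measurableI; [exact: measurable_itv|rewrite -[X in measurable X]setTI; exact: mf].
Qed.

Lemma ramp_ess_bounded (T : R) :
  exists M : R, {ae @lebesgue_measure R, forall t, t \in `[0, T] -> `|1 + t| <= M}.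
Proof.
exists (1 + T); exists set0; split; [exact: measurable0|exact: measure0|].
move=> t /= H; apply: H; rewrite in_itv /= => /andP[t0 tT].
by rewrite ger0_norm ?addr_ge0// lerD2l.
Qed.

Definition ramp_input (T : R) (T0 : 0 <= T) : input R :=
  Input T0 (@ramp_measurable T) (ramp_ess_bounded T).

(** On [[0, 1 / (16 C)]] the series with coefficients bounded by [C ^ k], and the series
    differentiated twice, converge, so termwise differentiation is legitimate and
    the recursion is the differential equation.  The derivative is bounded
    there, whence Lipschitz, hence absolute, continuity. *)
Lemma ramp_trajectory (n : nat) (s : system R n) (C : R) (T0 : 0 <= (16 * C)^-1) :
  ramp_rate s <= C ->
  exists2 x : R -> 'cV[R]_n, is_trajectory s (ramp_input T0) x &
    forall t, 0 <= t <= (16 * C)^-1 -> forall i,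
      pseries_sum (fun k => ramp_coef s k i 0) t (x t i 0).
Proof.
move=> sC; have C1 : 1 <= C := le_trans (ramp_rate_ge1 s) sC.
have C0 : 0 < C by rewrite (lt_le_trans _ C1).
pose f i k := ramp_coef s k i 0.
have fB i : geometric_bound (f i) 1 C by move=> k; rewrite mul1r; exact: ramp_coef_bound.
have C16 : C * (16 * C)^-1 = 16^-1 by field; rewrite gt_eqF.
have tC t : 0 <= t <= (16 * C)^-1 -> C * `|t| <= 16^-1.
  by move=> /andP[t0 tT]; rewrite ger0_norm// -C16 ler_wpM2l// ltW.
have t8 t : 0 <= t <= (16 * C)^-1 -> `|t| < (8 * C)^-1.
  move=> /andP[t0 tT]; rewrite ger0_norm// (le_lt_trans tT)// ltf_pV2 ?posrE ?mulr_gt0//.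
  by rewrite ltr_pM2r//; lra.
pose x t : 'cV[R]_n := \col_i limn (pseries (f i) t).
have xE i : (fun t => x t i 0) = (fun t => limn (pseries (f i) t)).
  by apply/funext => t; rewrite mxE.
have xs t : 0 <= t <= (16 * C)^-1 -> forall i, pseries_sum (f i) t (x t i 0).
  move=> tT i; rewrite mxE; apply: (pseries_cvg ler01 (ltW C0) (fB i)).
  by have := tC t tT; lra.
have fB1 i := geometric_bound_diffs ler01 (ltW C0) (fB i).
have dC1 : 0 <= 1 * C by rewrite mul1r ltW.
have C20 : 0 <= 2 * C by rewrite mulr_ge0// ltW.
have tC2 t : 0 <= t <= (16 * C)^-1 -> 2 * C * `|t| <= 2^-1.
  by move=> /tC; rewrite -mulrA; lra.
have dx t : 0 <= t <= (16 * C)^-1 -> forall i,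
    is_derive t 1 (fun t => x t i 0) (limn (pseries (pseries_diffs (f i)) t)).
  by move=> tT i; rewrite xE; apply: pseries_is_derive ler01 C0 (fB i) (t8 t tT).
exists x => //; split => /=.
- apply/colP => i; have T00 : 0 <= (0 : R) <= (16 * C)^-1 by rewrite lexx.
  have := xs 0 T00 i => /(cvg_lim _) <- //.
  by rewrite (cvg_lim _ (@pseries_sum_at0 _ (f i)))// /f /ramp_coef.
- move=> i; apply: (@lipschitz_abs_continuous _ _ _ _ (2 * (1 * C))).
    by rewrite mul1r mulr_gt0.
  move=> a b /andP[a0 aT] /andP[b0 bT] ab.
  have inT r : a <= r <= b -> 0 <= r <= (16 * C)^-1.
    by move=> /andP[ar rb]; rewrite (le_trans a0)//= (le_trans rb).
  have [||c cab ->] := @MVT_segment R (fun t => x t i 0)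
    (fun t => limn (pseries (pseries_diffs (f i)) t)) a b ab.
  - by move=> r; rewrite in_itv /= => /andP[ar rb]; apply: dx; apply: inT; rewrite !ltW.
  - apply: derivable_within_continuous => r; rewrite in_itv /= => rab.
    by case: (dx r (inT r rab) i).
  have cT : 0 <= c <= (16 * C)^-1 by apply: inT; move: cab; rewrite in_itv.
  rewrite normrM (ger0_norm (_ : 0 <= b - a)) ?subr_ge0// ler_wpM2r ?subr_ge0//.
  exact: (pseries_lim_bounded dC1 C20 (fB1 i) (tC2 c cT)).
exists set0; split; [exact: measurable0|exact: measure0|].
move=> t /= H; apply: H => tT i; have {}tT : 0 <= t <= (16 * C)^-1.
  by move: tT; rewrite in_itv /= => /andP[? ?]; rewrite !ltW.
have := dx t tT i; set l := limn _ => dxi.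
suff -> : ((sysA s + (1 + t) *: sysN s) *m x t + (1 + t) *: sysb s) i 0 = l by [].
have cl : pseries_sum (pseries_diffs (f i)) t l.
  exact: (pseries_cvg dC1 C20 (fB1 i) (tC2 t tT)).
rewrite -(cvg_lim _ cl)//; apply/esym/cvg_lim => //.
have -> : pseries_diffs (f i) = (fun k => ((\sum_j (sysA s + sysN s) i j * f j k) +
    (\sum_j sysN s i j * (ramp_coefs s k).2 j 0)) + sysb s i 0 * (k < 2)%N%:R).
  apply/funext => k; rewrite /pseries_diffs /f ramp_coefS mxE mulrA divff// mul1r.
  by rewrite !mxE mulrC.
have -> : ((sysA s + (1 + t) *: sysN s) *m x t + (1 + t) *: sysb s) i 0 =
   ((\sum_j (sysA s + sysN s) i j * x t j 0) +
    (\sum_j sysN s i j * (t * x t j 0))) + sysb s i 0 * (1 + t * 1).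
  rewrite mulr1 mxE [X in X + _]mxE [X in _ + X = _]mxE (mulrC (1 + t)); congr (_ + _).
  by rewrite -big_split /=; apply: eq_bigr => j _;
    rewrite [(sysA s + _ *: _) i j]mxE [(sysA s + sysN s) i j]mxE [(_ *: sysN s) i j]mxE; ring.
apply: pseries_sumD; last first.
  apply: pseries_sumZ; rewrite -[X in X + _]/((0 < 2)%N%:R : R).
  apply: (@pseries_sum_shift _ (fun k => (k < 2)%N%:R)).
  rewrite -[X in pseries_sum _ _ X]addr0 -(mulr0 t).
  exact: (@pseries_sum_shift _ (fun k => (k.+1 < 2)%N%:R) _ _ (@pseries_sum_0 _ t)).
apply: pseries_sumD; apply: pseries_sum_sum => j; apply: pseries_sumZ; first exact: xs.
rewrite -[t * _]add0r.
have e0 : (ramp_coefs s 0).2 j 0 = 0 by rewrite mxE.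
rewrite -[X in pseries_sum _ _ (X + _)]e0.
apply: (@pseries_sum_shift _ (fun k => (ramp_coefs s k).2 j 0)).
by under eq_fun do rewrite ramp_coefs2; exact: xs.
Qed.

End ramp.

(** * Distinguishing a system from its dual *)

Lemma ramp_coef4 (R : realType) (n : nat) (s : system R n) :
  let M := sysA s + sysN s in let N := sysN s in let b := sysb s in
  ramp_coef s 4 = 24^-1 *: (M *m (M *m (M *m b)) + M *m (M *m b) +
    2 *: (M *m (N *m b)) + 3 *: (N *m (M *m b)) + 3 *: (N *m b)).
Proof.
move=> M N b.
have a0 : ramp_coef s 0 = 0 by [].
have a1 : ramp_coef s 1 = b.
  by rewrite ramp_coefS a0 /= !mulmx0 !add0r invr1 !scale1r.
have a2 : ramp_coef s 2 = 2^-1 *: (M *m b + b).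
  by rewrite ramp_coefS ramp_coefs2 a0 a1 /= mulmx0 addr0 scale1r.
have a3 : ramp_coef s 3 = 6^-1 *: (M *m (M *m b) + M *m b + 2 *: (N *m b)).
  rewrite ramp_coefS ramp_coefs2 a1 a2 /= scale0r addr0 -/M -/N -scalemxAr mulmxDr.
  move: (M *m (M *m b)) (M *m b) (N *m b) => x y z.
  by apply/colP => i; rewrite !mxE; field.
rewrite ramp_coefS ramp_coefs2 a2 a3 /= scale0r addr0 -/M -/N -!scalemxAr !mulmxDr -scalemxAr.
move: (M *m (M *m (M *m b))) (M *m (M *m b)) (M *m (N *m b))
  (N *m (M *m b)) (N *m b) => x y z w v.
by apply/colP => i; rewrite !mxE; field.
Qed.

Lemma output_trmx (R : realType) (n : nat) (b : 'cV[R]_n) (c : 'rV[R]_n) (P : 'M[R]_n) :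
  (b^T *m (P^T *m c^T)) 0 0 = (c *m (P *m b)) 0 0.
Proof. by rewrite -!trmx_mul mulmxA mxE. Qed.

(** With [M = A + N], the terms of [24 a 4] that transposition does not leave invariant
    are [2 M N b + 3 N M b]; their orders are exchanged in the dual system, so the gap
    between the two values of [24 c a 4] is [c N M b - c M N b = c N A b - c A N b]. *)
Lemma ramp_output_coef4_gap (R : realType) (n : nat) (s : system R n) :
  (sysc s *m ramp_coef s 4) 0 0 - (sysc (dual_system s) *m ramp_coef (dual_system s) 4) 0 0 =
  - 24^-1 * commutator_form (sysA s) (sysN s) (sysb s) (sysc s).
Proof.
rewrite !ramp_coef4 /=; case: s => A N b c /=.
have tt (P Q : 'M[R]_n) (v : 'cV[R]_n) : P^T *m (Q^T *m v) = (Q *m P)^T *m v.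
  by rewrite trmx_mul mulmxA.
have trD : A^T + N^T = (A + N)^T by rewrite linearD.
rewrite trD !tt.
have lin (u : 'rV[R]_n) (x y z p q : 'cV[R]_n) :
    (u *m (24^-1 *: (x + y + 2 *: z + 3 *: p + 3 *: q))) 0 0 =
    24^-1 * ((u *m x) 0 0 + (u *m y) 0 0 +
      2 * (u *m z) 0 0 + 3 * (u *m p) 0 0 + 3 * (u *m q) 0 0).
  rewrite -scalemxAr !mulmxDr -!scalemxAr.
  by move: (u *m x) (u *m y) (u *m z) (u *m p) (u *m q) => ? ? ? ? ?; rewrite !mxE.
rewrite !lin !output_trmx.
have -> : commutator_form A N b c =
    (c *m ((A + N) *m (N *m b))) 0 0 - (c *m (N *m ((A + N) *m b))) 0 0.
  rewrite /commutator_form -mulmxA mulmxBl !mulmxDl !mulmxDr mulmxN !mulmxA.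
  move: (c *m A *m N *m b) (c *m N *m A *m b) (c *m N *m N *m b) => x y z.
  by rewrite !mxE; ring.
by rewrite -!mulmxA; ring.
Qed.

Lemma dual_commutator_form (R : realType) (n : nat) (s : system R n) :
  commutator_form (sysA (dual_system s)) (sysN (dual_system s)) (sysb (dual_system s))
    (sysc (dual_system s)) = - commutator_form (sysA s) (sysN s) (sysb s) (sysc s).
Proof.
case: s => A N b c; rewrite /commutator_form /= -mulmxA -!trmx_mul -linearB /= output_trmx.
by rewrite mulmxA -[N *m A - _]opprB mulmxN mulNmx mxE.
Qed.

(** Equality of the outputs for the input [1 + t] would make the difference of their
    power series vanish on an interval, contradicting the gap between their
    fourth coefficients.  The sum of the two rates serves both systems, which
    must share the duration of the input. *)
Lemma dual_not_io_equiv (R : realType) (n : nat) (s : system R n) :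
  commutator_form (sysA s) (sysN s) (sysb s) (sysc s) != 0 -> ~ io_equiv s (dual_system s).
Proof.
move=> s0 eqv; set s' := dual_system s in eqv.
pose C := ramp_rate s + ramp_rate s'.
have r1 := ramp_rate_ge1 s; have r2 := ramp_rate_ge1 s'.
have sC : ramp_rate s <= C by rewrite lerDl; lra.
have sC' : ramp_rate s' <= C by rewrite lerDr; lra.
have C0 : 0 < C by rewrite /C; lra.
have T0 : 0 <= (16 * C)^-1 by rewrite invr_ge0 mulr_ge0// ltW.
have [x tr xs] := ramp_trajectory T0 sC.
have [x' tr' xs'] := ramp_trajectory T0 sC'.
pose out (p : system R n) k := (sysc p *m ramp_coef p k) 0 0.
have outE (p : system R n) (z : 'cV[R]_n) t :
    (forall i, pseries_sum (fun k => ramp_coef p k i 0) t (z i 0)) ->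
    pseries_sum (out p) t ((sysc p *m z) 0 0).
  move=> pz; rewrite mxE /out; under eq_fun do rewrite mxE.
  by apply: pseries_sum_sum => j; exact: pseries_sumZ.
have outB p : ramp_rate p <= C -> geometric_bound (out p) (entry_sum (sysc p)) C.
  move=> pC k; apply: mulmx_entry_bound => [|j]; first by rewrite exprn_ge0// ltW.
  exact: ramp_coef_bound.
pose d k := out s k + -1 * out s' k.
have dB : geometric_bound d (entry_sum (sysc s) + entry_sum (sysc s')) C.
  move=> k; rewrite /d mulN1r mulrDl (le_trans (ler_normB _ _))//.
  by apply: lerD; apply: outB.
have d0 t : 0 < t < (16 * C)^-1 -> pseries_sum d t 0.
  move=> /andP[t0 tT]; have tT' : 0 <= t <= (16 * C)^-1 by rewrite !ltW.
  have E : (sysc s *m x t) 0 0 = (sysc s' *m x' t) 0 0.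
    by apply: (@eqv (ramp_input T0) I (fun t => (sysc s *m x t) 0 0)
      (fun t => (sysc s' *m x' t) 0 0)); [exists x|exists x'|rewrite in_itv].
  have -> : 0 = (sysc s *m x t) 0 0 + -1 * (sysc s' *m x' t) 0 0.
    by rewrite mulN1r E subrr.
  apply: pseries_sumD; first by apply: outE => i; exact: xs.
  by apply: pseries_sumZ; apply: outE => i; exact: xs'.
have B0 : 0 <= entry_sum (sysc s) + entry_sum (sysc s') by rewrite addr_ge0// entry_sum_ge0.
have T1 : 0 < (16 * C)^-1 by rewrite invr_gt0 mulr_gt0.
have := pseries_vanish 4 B0 C0 dB T1 d0.
rewrite /d mulN1r ramp_output_coef4_gap => /eqP.
by rewrite mulf_eq0 (negbTE s0) orbF oppr_eq0 invr_eq0 pnatr_eq0.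
Qed.

Theorem corollary3p2 (R : realType) (n : nat) (hn : (2 <= n)%N) :
  exists G : set (system R n),
    generic (@coords R n @` G) /\
    forall s : system R n, G s ->
      exists s' : system R n,
        [/\ G s',
            io_equiv_under (@constant_input R) s s' &
            ~ io_equiv s s'].
Proof.
exists [set s | commutator_form (sysA s) (sysN s) (sysb s) (sysc s) != 0]; split.
  by apply: (@generic_commutator R n (Ordinal (ltnW hn)) (Ordinal hn)).
move=> s s0; exists (dual_system s); split.
- by rewrite /= dual_commutator_form oppr_eq0.
- exact: dual_io_equiv_constant.
- exact: dual_not_io_equiv.
Qed.
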